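(* Let $p\in(1,2)$ be fixed and let $E_p(\beta):=\lim_{n\to\infty}\frac1n\log\mathcal{Z}_{n,p}(\beta)$ for $\beta\ge0$. Then for every $y\ge 0$, \[ \sup_{z\ge 0 }\left(\psi_{p}\big(\sqrt{y}\,z/(1+|z|^p)^{1/p}\big)-\frac1p\log(1+|z|^p)\right) =\sup_{x\ge 0}\left\{E_p(x y )-\frac{2-p}{2p}x^{\frac{p}{2-p}}\right\}. \] In particular, for $\beta\ge0$, \[ \lim_{n\to\infty}\frac1n\log\mathcal{Z}_{n,p}(\beta) \le \inf_{w> 0 }\sup_{z\ge 0 }\left\{\psi_{p}\left(\frac{\sqrt{\beta}\, zw}{(1+z^p)^{1/p}}\right)-\frac1p\log(1+|z|^p)+\frac{2-p}{2p}w^{\frac{2p}{p-2}}\right\}. \]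
   Context: For $p>0$ let $\rho_p(x)=c_p e^{-|x|^p/p}$, $x\in\mathbb{R}$, with $c_p=\frac{p^{-1/p}}{2\Gamma(1+1/p)}$, and $\psi_p(t):=\log\mathbb{E}[e^{tX}]$ for $X\sim\rho_p$. Let $S_{n,p}:=\{\sigma\in\mathbb{R}^n: \frac1n\sum_{i=1}^n|\sigma_i|^p=1\}$ with the uniform probability measure $d_{n,p}\sigma$ (the law of $X/\|X\|_{n,p}$ with $X_1,\dots,X_n$ i.i.d. $\rho_p$, $\|x\|_{n,p}=(\frac1n\sum_i|x_i|^p)^{1/p}$). With $H_n(\sigma)=\frac1n\sum_{i<j}\sigma_i\sigma_j$, the partition function is $\mathcal{Z}_{n,p}(\beta)=\int_{S_{n,p}}\exp(\beta H_n(\sigma))\,d_{n,p}\sigma$. (The limit defining $E_p$ exists for $p>1$.) *)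

(* Defs.v *)
From HB Require Import structures.
From mathcomp Require Import all_boot all_order all_algebra.
From mathcomp Require Import all_classical all_reals all_analysis.
Set Implicit Arguments. Unset Strict Implicit. Unset Printing Implicit Defensive.
Import Order.TTheory GRing.Theory Num.Theory.
Import numFieldNormedType.Exports.
Local Open Scope classical_set_scope.
Local Open Scope ring_scope.

Section Defs.
Variable R : realType.

Definition Gamma (s : R) : R :=
  fine (\int[@lebesgue_measure R]_(t in [set t : R | 0 < t])
          ((t `^ (s - 1)) * expR (- t))%:E).

Definition c_p (p : R) : R := p `^ (- p^-1) / (2 * Gamma (1 + p^-1)).

Definition rho (p : R) (x : R) : R := c_p p * expR (- (`|x| `^ p) / p).

Definition psi (p : R) (t : R) : R :=
  ln (fine (\int[@lebesgue_measure R]_x (expR (t * x) * rho p x)%:E)).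

(* iterated Lebesgue integral over R^n of a function of the coordinate list
   (for nonnegative integrands this is the integral w.r.t. Lebesgue measure
   on R^n, by Tonelli) *)
Fixpoint iter_int (n : nat) (f : seq R -> \bar R) : \bar R :=
  match n with
  | 0%N => f [::]
  | n'.+1 => \int[@lebesgue_measure R]_x iter_int n' (fun s => f (x :: s))
  end.

Definition pnorm (p : R) (x : seq R) : R :=
  ((size x)%:R^-1 * \sum_(i < size x) `|x`_i| `^ p) `^ p^-1.

Definition Ham (s : seq R) : R :=
  (size s)%:R^-1 * \sum_(i < size s) \sum_(j < size s | (i < j)%N) s`_i * s`_j.

(* Z_{n,p}(beta) = E[exp(beta H_n(X/||X||_{n,p}))], X_1..X_n iid rho_p
   (the law of X/||X||_{n,p} is the uniform measure d_{n,p} on S_{n,p}).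
   The null set {x = 0} is assigned the value 0. *)
Definition Zpart (n : nat) (p beta : R) : R :=
  fine (iter_int n (fun x =>
    ((if pnorm p x == 0 then 0
      else expR (beta * Ham [seq xi / pnorm p x | xi <- x]))
     * \prod_(xi <- x) rho p xi)%:E)).

Definition Ep (p beta : R) : R :=
  lim ((fun n : nat => n%:R^-1 * ln (Zpart n p beta)) @ \oo).

End Defs.

(* Main.v *)
Require Import Defs.
From HB Require Import structures.
From mathcomp Require Import all_boot all_order all_algebra.
From mathcomp Require Import all_classical all_reals all_analysis.
From mathcomp Require Import measurable_realfun ring lra.
Import Order.TTheory GRing.Theory Num.Theory.
Import numFieldNormedType.Exports.
Local Open Scope classical_set_scope.
Local Open Scope ring_scope.

(** Write [R^p = (1/n) sum |X_i|^p], [m] for the mean of the coordinates of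
[X / R], and [Lam s = lim (1/n) log E exp (s n m)]. Since [b m^2 / 2] is the
supremum over [s] of [sqrt b s m - s^2 / 2], attained up to [eta] on a finite
grid, and since the diagonal of the Hamiltonian is negligible for [p > 1],
[E_p b = sup_s (Lam (sqrt b s) - s^2 / 2)]; the right-hand side of the identity
then becomes [sup_u (Lam (sqrt y u) - u^p / p)] by Young's inequality, with
equality for [x = u^(2-p)], [s = u^(p/2)].

The law of [R] is never computed. Rescaling the integral of
[exp (- c sum |x_i|^p / p)] against a weight that is homogeneous of degree 0
only multiplies it by [c^(-n/p)], so Chernoff's bound shows that [R] concentrates
at 1 under every such weight; similarly [R] concentrates under the tilts
[exp (t sum x_i)]. Comparing the two on a thin shell gives
[Lam s <= Phi s r := psi (s/r) + (r^p - 1) / p - ln r] for all [r > 0], with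
equality when [r^p] is the mean of [|X|^p] under the tilt [t = s / r]. Such an [r]
exists for every [s] (a minimizer of [Phi s]) and for every [t].

Taking [r^p = 1 + z^p] in [Lam <= Phi] bounds the right-hand side of the identity by
the left-hand side; the converse uses the equality case and [ln v <= v - 1]. *)

(** * Iterated integrals and their measurability *)

Section IteratedIntegral.
Set Implicit Arguments. Unset Strict Implicit.
Context {R : realType}.
Implicit Type p : R.
Local Notation mu := (@lebesgue_measure R).
Local Open Scope ereal_scope.

(** The integral of a nonnegative function is a supremum over the simple functions below it, so it
    is monotone even on nonmeasurable functions. This lets the integrand of [Zpart] be compared with
    others before its measurability is known. *)
Lemma le_integral_nonneg (f g : R -> \bar R) : (forall x, 0 <= f x) ->
  (forall x, f x <= g x) -> \int[mu]_x f x <= \int[mu]_x g x.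
Proof.
move=> f0 fg; rewrite !ge0_integralTE//; last by move=> x; apply: le_trans (fg x).
by apply: ereal_sup_le => _ [h hf <-]; exists h => // x; apply: le_trans (fg x).
Qed.

Lemma iter_int_ge0 n (f : seq R -> \bar R) :
  (forall s, 0 <= f s) -> 0 <= iter_int n f.
Proof.
by elim: n f => [|n IH] f f0 //=; apply: integral_ge0 => x _; apply: IH.
Qed.

Lemma iter_int_le n (f g : seq R -> \bar R) : (forall s, 0 <= f s) ->
  (forall s, size s = n -> f s <= g s) -> iter_int n f <= iter_int n g.
Proof.
elim: n f g => [|n IH] f g f0 fg /=; first exact: fg.
apply: le_integral_nonneg => x; first by apply: iter_int_ge0.
by apply: IH => // s sn; apply: fg; rewrite /= sn.
Qed.

(* All integrands depend on [x] only through [(sum x_i, sum |x_i|^p)], so this pair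
is accumulated in place of the list of coordinates; measurability then only concerns
functions on the plane. *)
Definition addst p (a : R * R) (x : R) : R * R := (a.1 + x, a.2 + `|x| `^ p)%R.

Fixpoint stint p (n : nat) (phi : R * R -> \bar R) (a : R * R) : \bar R :=
  match n with
  | 0%N => phi a
  | n'.+1 => \int[mu]_x stint p n' phi (addst p a x)
  end.

Lemma iter_int_stint p n phi a :
  iter_int n (fun s => phi (foldl (addst p) a s)) = stint p n phi a.
Proof. by elim: n a => [|n IH] a //=; apply: eq_integral => x _; exact: IH. Qed.

Lemma foldl_addst p a s : foldl (addst p) a s =
  (a.1 + \sum_(x <- s) x, a.2 + \sum_(x <- s) `|x| `^ p)%R.
Proof.
elim: s a => [|x s IH] a /=; first by rewrite !big_nil !addr0 -surjective_pairing.
by rewrite IH !big_cons /= !addrA.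
Qed.

Lemma measurable_normp p : measurable_fun setT (fun x : R => `|x| `^ p)%R.
Proof.
by apply: (measurableT_comp (measurable_powR _)); exact: normr_measurable.
Qed.

Lemma measurable_addst p :
  measurable_fun setT (fun z : (R * R) * R => addst p z.1 z.2).
Proof.
apply/measurable_fun_pairP; split => /=.
  apply: measurable_funD; last exact: measurable_snd.
  exact: (measurableT_comp measurable_fst measurable_fst).
apply: measurable_funD.
  exact: (measurableT_comp measurable_snd measurable_fst).
by apply: (measurableT_comp (measurable_normp p)); exact: measurable_snd.
Qed.

Definition nneg_meas (phi : R * R -> \bar R) :=
  measurable_fun setT phi /\ forall a, 0 <= phi a.

(** Tonelli: integrating out one more coordinate keeps measurability in the accumulated state. *)
Lemma nneg_meas_stint p n phi : nneg_meas phi -> nneg_meas (stint p n phi).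
Proof.
move=> phim; elim: n => [|n [IHm IH0]] //; split; last first.
  by move=> a; apply: integral_ge0 => x _.
have := @measurable_fun_fubini_tonelli_F _ _ (R * R)%type _ _ mu
  (fun z => stint p n phi (addst p z.1 z.2)).
apply => //; apply: (measurableT_comp IHm); exact: measurable_addst.
Qed.

Lemma measurable_stint_addst p n phi a : nneg_meas phi ->
  measurable_fun setT (fun x => stint p n phi (addst p a x)).
Proof.
move=> /(nneg_meas_stint p n) [m0 _].
apply: (measurableT_comp (measurableT_comp m0 (measurable_addst p)) (pair1_measurable a)).
Qed.

End IteratedIntegral.

(** * Linearity and change of variables for iterated integrals *)

Section Scaling.
Set Implicit Arguments. Unset Strict Implicit.
Context {R : realType}.
Implicit Type p : R.
Local Notation mu := (@lebesgue_measure R).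
Local Open Scope ereal_scope.

Lemma ge0_integral_oppr (f : R -> \bar R) : measurable_fun setT f ->
  (forall x, 0 <= f x) -> \int[mu]_x f (- x)%R = \int[mu]_x f x.
Proof.
move=> mf f0.
transitivity (\int[pushforward mu (-%R : _ -> measurableTypeR R)]_x f x).
  by rewrite ge0_integral_pushforward//= => x _.
by apply: eq_measure_integral => //= A mA AS; exact: lebesgue_measureN.
Qed.

(** Both sides agree on half-open intervals, and Lebesgue measure is determined by those. *)
Lemma lebesgue_measureM (l : R) (A : set R) : (0 < l)%R -> measurable A ->
  l%:E * pushforward mu ( *%R l : _ -> measurableTypeR R) A = mu A.
Proof.
move=> l0 mA.
have mk : measurable_fun setT ( *%R l : R -> measurableTypeR R).
  by apply: measurable_funM => //; exact: measurable_id.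
pose m : {measure set (measurableTypeR R) -> \bar R} :=
  measure_function_pushforward__canonical__measure_function_Measure mu mk.
apply/esym/(@lebesgue_measure_unique _ (mscale (NngNum (ltW l0)) m)) => //.
move=> _ [[a b]] _ <-; rewrite -[RHS]/(l%:E * mu (( *%R l) @^-1` `]a, b])).
rewrite [X in _ = _ * mu X](_ : _ = `](l^-1 * a)%R, (l^-1 * b)%R]%classic); last first.
  apply/seteqP; split => x /=; rewrite !in_itv /=.
    by move=> /andP[ax xb]; rewrite ler_pdivlMl// ltr_pdivrMl// ax.
  by rewrite ler_pdivlMl// ltr_pdivrMl.
rewrite !lebesgue_measure_itv/= !lte_fin ltr_pM2l ?invr_gt0//.
case: ifP => _; last by rewrite mule0.
by rewrite -!EFinD -EFinM -mulrBr mulVKf// gt_eqF.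
Qed.

Lemma ge0_integral_scale (l : R) (f : R -> \bar R) : (0 < l)%R ->
  measurable_fun setT f -> (forall x, 0 <= f x) ->
  \int[mu]_x f (l * x)%R = l^-1%:E * \int[mu]_x f x.
Proof.
move=> l0 mf f0; pose k := NngNum (ltW l0).
have mk : measurable_fun setT ( *%R l : measurableTypeR R -> measurableTypeR R).
  by apply: measurable_funM => //; exact: measurable_id.
rewrite -[in LHS](preimage_setT ( *%R l)) -(@ge0_integral_pushforward _ _ _ _ _ _ mk mu setT f)//.
pose m : {measure set (measurableTypeR R) -> \bar R} :=
  measure_function_pushforward__canonical__measure_function_Measure mu mk.
rewrite -[in RHS](@eq_measure_integral _ _ _ _ mu (mscale k m)); last first.
  by move=> A mA _; exact: lebesgue_measureM.
by rewrite ge0_integral_mscale//= muleA -EFinM mulVf ?gt_eqF// mul1e.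
Qed.

Lemma stintD p n phi psi a : nneg_meas phi -> nneg_meas psi ->
  stint p n (fun b => phi b + psi b) a = stint p n phi a + stint p n psi a.
Proof.
move=> hphi hpsi; elim: n a => [|n IH] a //=.
under eq_integral do rewrite IH.
rewrite ge0_integralD//; try exact: measurable_stint_addst.
- by move=> *; apply: (nneg_meas_stint p n hphi).2.
- by move=> *; apply: (nneg_meas_stint p n hpsi).2.
Qed.

Lemma stintZ p n phi a (k : R) : (0 <= k)%R -> nneg_meas phi ->
  stint p n (fun b => k%:E * phi b) a = k%:E * stint p n phi a.
Proof.
move=> k0 hphi; elim: n a => [|n IH] a //=.
under eq_integral do rewrite IH.
rewrite ge0_integralZl_EFin//; last exact: measurable_stint_addst.
by move=> x _; apply: (nneg_meas_stint p n hphi).2.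
Qed.

Lemma eq_stint p n phi psi : phi =1 psi -> stint p n phi =1 stint p n psi.
Proof. by move=> /funext ->. Qed.

(** The comparison is asked only at states reached from the origin by [n] coordinates. Bounds such
    as the power mean inequality hold there but fail on the whole plane. *)
Lemma stint_le p n phi psi : (forall a, 0 <= phi a) ->
  (forall s, size s = n -> phi (foldl (addst p) (0, 0) s)%R <=
                           psi (foldl (addst p) (0, 0) s)%R) ->
  stint p n phi (0, 0)%R <= stint p n psi (0, 0)%R.
Proof.
by move=> h0 h; rewrite -!iter_int_stint; apply: iter_int_le.
Qed.

(** Substituting [l * x] in each coordinate costs a factor [l^-1] each and acts on the state by
    [(l, l ^ p)]. *)
Lemma stint_scale p n (l : R) phi a : (0 < l)%R -> nneg_meas phi ->
  stint p n (fun b => phi (l * b.1, l `^ p * b.2)%R) a =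
  (l^-1 ^+ n)%:E * stint p n phi (l * a.1, l `^ p * a.2)%R.
Proof.
move=> l0 hphi; elim: n a => [|n IH] a /=; first by rewrite expr0 mul1e.
under eq_integral do rewrite IH.
have hst := nneg_meas_stint p n hphi.
pose g x := stint p n phi (addst p (l * a.1, l `^ p * a.2)%R x).
have mg : measurable_fun setT g by exact: measurable_stint_addst.
have g0 x : 0 <= g x by exact: hst.2.
under eq_integral => x _.
  rewrite (_ : stint _ _ _ _ = g (l * x)%R); last first.
    rewrite /g /addst /=; congr (stint _ _ _ (_, _)); first by rewrite mulrDr.
    by rewrite mulrDr normrM powRM// (gtr0_norm l0).
  over.
have mgl : measurable_fun setT (fun x => g (l * x)%R).
  by apply: (measurableT_comp mg); exact: measurable_funM.
have ln0 : (0 <= l^-1 ^+ n)%R by rewrite exprn_ge0// invr_ge0 ltW.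
rewrite (@ge0_integralZl_EFin _ _ _ mu _ measurableT _ (fun x _ => g0 _) mgl _ ln0).
by rewrite (ge0_integral_scale l0 mg g0) muleA -EFinM -exprSr.
Qed.

(** [u] is an eigenfunction of the one-coordinate integration operator; this replaces factorization
    over independent coordinates. *)
Lemma stint_eigen p n (u : R * R -> R) (k : R) a : (0 <= k)%R ->
  measurable_fun setT u -> (forall b, 0 <= u b)%R ->
  (forall b, \int[mu]_x (u (addst p b x))%:E = (k * u b)%:E) ->
  stint p n (EFin \o u) a = (k ^+ n * u a)%:E.
Proof.
move=> k0 mu0 u0 hu; elim: n a => [|n IH] a /=; first by rewrite expr0 mul1r.
under eq_integral do rewrite IH EFinM.
rewrite ge0_integralZl_EFin ?hu ?exprn_ge0// -?EFinM ?exprSr ?mulrA//.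
- by move=> x _; rewrite lee_fin.
- apply/measurable_EFinP; apply: (measurableT_comp mu0).
  exact: (measurableT_comp (measurable_addst p) (pair1_measurable a)).
Qed.

End Scaling.

(** * Exponential integrals in one variable *)

Definition yp {R : realType} (p x : R) : R := `|x| `^ p / p.

(* Locked, as unification would otherwise unfold the integral. *)
HB.lock Definition kint {R : realType} (p t c : R) : R :=
  \int[@lebesgue_measure R]_x expR (t * x - c * yp p x).

Section ExponentialIntegrals.
Set Implicit Arguments. Unset Strict Implicit.
Context {R : realType}.
Implicit Types p t c : R.
Local Notation mu := (@lebesgue_measure R).

Lemma yp_ge0 p x : 0 < p -> 0 <= yp p x.
Proof. by move=> p0; rewrite divr_ge0 ?powR_ge0 ?ltW. Qed.

Lemma ypN p x : yp p (- x) = yp p x.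
Proof. by rewrite /yp normrN. Qed.

Lemma ypM p (l x : R) : 0 <= l -> yp p (l * x) = l `^ p * yp p x.
Proof. by move=> l0; rewrite /yp normrM ger0_norm// powRM// mulrA. Qed.

Lemma measurable_yp p : measurable_fun setT (yp p).
Proof. by apply: measurable_funM => //; exact: measurable_normp. Qed.

Lemma measurable_expR_kernel p t c :
  measurable_fun setT (fun x : R => expR (t * x - c * yp p x)).
Proof.
apply: measurableT_comp; first exact: measurable_expR.
apply: measurable_funB; first exact: measurable_funM.
by apply: measurable_funM => //; exact: measurable_yp.
Qed.

(** Dominated by [k^-1] times the exponential density of rate [k] plus its reflection. *)
Lemma integrable_expRN_normr (k : R) : 0 < k ->
  mu.-integrable setT (EFin \o (fun x : R => expR (- (k * `|x|)))).
Proof.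
move=> k0; pose f (x : R) := exponential_pdf k x : R.
have mf : measurable_fun setT f by exact: measurable_exponential_pdf.
have f0 x : 0 <= f x by apply: exponential_pdf_ge0; exact: ltW.
have intf : mu.-integrable setT (EFin \o f).
  apply/integrableP; split; first exact/measurable_EFinP.
  under eq_integral do rewrite /= ger0_norm//.
  by rewrite integral_exponential_pdf// ltry.
have intfN : mu.-integrable setT (EFin \o (fun x : R => f (- x))).
  have mfN : measurable_fun setT (fun x : R => f (- x)).
    by apply: (measurableT_comp mf); exact: oppr_measurable.
  apply/integrableP; split; first exact/measurable_EFinP.
  under eq_integral do rewrite /= ger0_norm//.
  rewrite (@ge0_integral_oppr _ (EFin \o f)) ?integral_exponential_pdf ?ltry//.
  exact/measurable_EFinP.
apply: le_integrable (integrableZl measurableT k^-1 (integrableD measurableT intf intfN)) => //.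
  apply/measurable_EFinP; apply: measurableT_comp; first exact: measurable_expR.
  apply: measurableT_comp; first exact: oppr_measurable.
  by apply: measurable_funM => //; exact: normr_measurable.
move=> x _; rewrite /= lee_fin ger0_norm ?expR_ge0// [leRHS]ger0_norm; last first.
  by rewrite mulr_ge0 ?addr_ge0// invr_ge0 ltW.
rewrite ler_pdivlMl//.
have [x0|x0] := leP 0 x.
  by rewrite {1}/f exponential_pdfE// ger0_norm// mulNr lerDl.
rewrite {2}/f exponential_pdfE; last by rewrite oppr_ge0 ltW.
by rewrite ltr0_norm// mulNr lerDr.
Qed.

(** Young's inequality for the conjugate exponents [p] and [p / (p - 1)], applied to [c^(1/p) |x|]
    and [|a| c^(-1/p)]. This is where [p > 1] makes all exponential tilts integrable. *)
Lemma young_yp p (a c : R) : 1 < p -> 0 < c ->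
  exists C, forall x, a * `|x| <= c * yp p x + C.
Proof.
move=> p1 c0; have p0 : 0 < p by lra.
pose q := p / (p - 1).
have q0 : 0 < q by rewrite divr_gt0// subr_gt0.
exists ((`|a| * (c `^ p^-1)^-1) `^ q / q) => x.
have cp0 : 0 < c `^ p^-1 by rewrite powR_gt0.
apply: (@le_trans _ _ ((c `^ p^-1 * `|x|) * (`|a| * (c `^ p^-1)^-1))).
  rewrite (_ : _ * _ * _ = `|a| * `|x|); last by field; rewrite gt_eqF.
  by rewrite ler_wpM2r// ler_norm.
have := @conjugate_powR R (c `^ p^-1 * `|x|) (`|a| * (c `^ p^-1)^-1) p q.
move=> /(_ _ _ p0 q0 _)/le_trans; apply.
- by rewrite mulr_ge0// ltW.
- by rewrite mulr_ge0// invr_ge0 ltW.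
- by rewrite /q invf_div; field; rewrite gt_eqF//=; lra.
rewrite lerD2r powRM ?powR_ge0// -powRrM mulVf ?gt_eqF// powRr1 ?(ltW c0)//.
by rewrite /yp mulrA.
Qed.

Lemma integrable_kernel_bound p (f : R -> R) (B b c : R) : 1 < p -> 0 < c ->
  measurable_fun setT f -> (forall x, `|f x| <= B * expR (b * `|x| - c * yp p x)) ->
  mu.-integrable setT (EFin \o f).
Proof.
(* The slope [b + 1] in place of [b] leaves an integrable factor [exp (- |x|)]. *)
move=> p1 c0 mf fB; have [C hC] := young_yp (b + 1) p1 c0.
have B0 : 0 <= B.
  have := le_trans (normr_ge0 _) (fB 0).
  by rewrite pmulr_lge0// expR_gt0.
apply: le_integrable (integrableZl measurableT (B * expR C) (integrable_expRN_normr ltr01)).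
- by [].
- exact/measurable_EFinP.
move=> x _ /=; rewrite lee_fin (le_trans (fB x))// [leRHS]ger0_norm; last first.
  by rewrite !mulr_ge0// expR_ge0.
rewrite -mulrA ler_wpM2l// -expRD ler_expR.
by have := hC x; rewrite mulrDl !mul1r; lra.
Qed.

Lemma integrable_expR_kernel p t c : 1 < p -> 0 < c ->
  mu.-integrable setT (EFin \o (fun x => expR (t * x - c * yp p x))).
Proof.
move=> p1 c0; apply: (@integrable_kernel_bound p _ 1 `|t| c) => //.
  exact: measurable_expR_kernel.
move=> x; rewrite mul1r ger0_norm ?expR_ge0// ler_expR lerD2r -normrM.
exact: ler_norm.
Qed.

Lemma kintE p t c : 1 < p -> 0 < c ->
  (\int[mu]_x (expR (t * x - c * yp p x))%:E)%E = (kint p t c)%:E.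
Proof.
move=> p1 c0; rewrite kint.unlock fineK//.
by apply: integrable_fin_num => //; exact: integrable_expR_kernel.
Qed.

Lemma kintN p t c : 1 < p -> 0 < c -> kint p (- t) c = kint p t c.
Proof.
move=> p1 c0; apply: EFin_inj; rewrite -(kintE t p1 c0) -(kintE (- t) p1 c0).
have /= := @ge0_integral_oppr R (EFin \o (fun x => expR (t * x - c * yp p x))).
move=> <-.
- by apply: eq_integral => x _; rewrite ypN mulrN mulNr.
- by apply/measurable_EFinP; exact: measurable_expR_kernel.
- by move=> x; rewrite lee_fin expR_ge0.
Qed.

Lemma kint_scale p t c : 1 < p -> 0 < c ->
  kint p t c = c `^ (- p^-1) * kint p (t * c `^ (- p^-1)) 1.
Proof.
move=> p1 c0; have p0 : 0 < p by lra.
pose l := c `^ (p^-1).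
have l0 : 0 < l by rewrite powR_gt0.
have lp : l `^ p = c by rewrite /l -powRrM mulVf ?gt_eqF// powRr1// ltW.
rewrite !powRN -/l; apply: EFin_inj; rewrite EFinM.
rewrite -(kintE t p1 c0) -(kintE (t / l) p1 ltr01).
have /= := @ge0_integral_scale R l (EFin \o (fun x => expR (t / l * x - 1 * yp p x))).
move=> <-.
- apply: eq_integral => x _; rewrite ypM ?ltW// lp mul1r mulrA.
  by rewrite divfK ?gt_eqF.
- by [].
- by apply/measurable_EFinP; exact: measurable_expR_kernel.
- by move=> x; rewrite lee_fin expR_ge0.
Qed.

Lemma integral_itv12_gt0 (f : R -> R) (b : R) : 0 < b -> (forall x, 0 <= f x) ->
  (forall x, 1 <= x <= 2 -> b <= f x) -> (0 < \int[mu]_x (f x)%:E)%E.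
Proof.
move=> b0 f0 bf; apply: (@lt_le_trans _ _ (\int[mu]_(x in `[1%R, 2%R]) b%:E)%E).
  rewrite integral_cst//= lebesgue_measure_itv/= lte_fin ltr1n -EFinD -EFinM.
  by rewrite lte_fin mulr_gt0//; lra.
rewrite integral_mkcond; apply: le_integral_nonneg => x.
  by rewrite patchE; case: ifP => // _; rewrite lee_fin ltW.
rewrite patchE; case: ifPn; last by rewrite lee_fin f0.
by rewrite inE/= in_itv/= => x12; rewrite lee_fin bf.
Qed.

Lemma kernel_ge_itv12 p t c (x : R) : 0 < p -> 0 < c -> 1 <= x <= 2 ->
  expR (- (`|t| * 2) - c * (2 `^ p / p)) <= expR (t * x - c * yp p x).
Proof.
move=> p0 c0 /andP[x1 x2]; have x0 : 0 <= x by lra.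
rewrite ler_expR; apply: lerB.
  rewrite lerNl -mulNr (le_trans (ler_norm _))// normrM normrN.
  by rewrite (ger0_norm x0) ler_wpM2l.
rewrite ler_wpM2l ?(ltW c0)// /yp ler_wpM2r ?invr_ge0 ?(ltW p0)//.
by rewrite ger0_norm// ge0_ler_powR// ?nnegrE// ltW.
Qed.

Lemma kint_gt0 p t c : 1 < p -> 0 < c -> 0 < kint p t c.
Proof.
move=> p1 c0; have p0 : 0 < p by lra.
suff : (0 < \int[mu]_x (expR (t * x - c * yp p x))%:E)%E by rewrite kintE// lte_fin.
apply: integral_itv12_gt0 (expR_gt0 _) (fun x => expR_ge0 _) _ => x.
exact: kernel_ge_itv12.
Qed.

(** By symmetry the values at [t] and [- t] coincide, and their average has integrand [cosh (t x)]
    times the kernel at [t = 0]. *)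
Lemma kint_min p t c : 1 < p -> 0 < c -> kint p 0 c <= kint p t c.
Proof.
move=> p1 c0.
suff : 2 * kint p 0 c <= kint p t c + kint p (- t) c.
  by rewrite (kintN t p1 c0); move: (kint p 0 c) (kint p t c) => u v; lra.
rewrite kint.unlock -RintegralD//; try exact: integrable_expR_kernel.
rewrite -RintegralZl//; last exact: integrable_expR_kernel.
apply: le_Rintegral => //.
- by apply: (integrableZl measurableT 2 (integrable_expR_kernel 0 p1 c0)).
- by apply: (integrableD measurableT (integrable_expR_kernel t p1 c0)
    (integrable_expR_kernel (- t) p1 c0)).
move=> x _; rewrite mul0r add0r !expRD mulNr -mulrDl ler_wpM2r ?expR_ge0//.
have := expR_ge1Dx (t * x); have := expR_ge1Dx (- (t * x)); lra.
Qed.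

Lemma expR_le_quad (u : R) : expR u <= 1 + u + u ^+ 2 * expR `|u|.
Proof.
have [u0|u0] := leP 0 u.
  have h1 := expR_ge1Dx (- u); have e0 := expR_gt0 u.
  have h2 : expR u - 1 <= u * expR u.
    by move: h1; rewrite expRN => /(ler_wpM2r (ltW e0)); rewrite mulVf ?gt_eqF//; lra.
  have h3 : u * expR u - u <= u ^+ 2 * expR u.
    by rewrite -[X in _ - X]mulr1 -mulrBr expr2 -mulrA ler_wpM2l.
  by rewrite (ger0_norm u0); lra.
have hN := expR_ge1Dx (- u); have e0 := expR_gt0 u.
have h2 : expR u * (1 - u) <= 1.
  by move: hN; rewrite expRN => /(ler_wpM2r (ltW e0)); rewrite mulVf ?gt_eqF//; lra.
have h3 : expR u <= 1 + u + u ^+ 2.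
  rewrite -(ler_pM2r (_ : 0 < 1 - u)); last by lra.
  apply: (le_trans h2); rewrite -subr_ge0.
  (* [(1 + u + u^2) (1 - u) = 1 - u^3], and [u < 0] here. *)
  rewrite (_ : _ - 1 = (- u) ^+ 3); last by ring.
  by rewrite exprn_ge0//; lra.
apply: (le_trans h3); rewrite lerD2l ler_peMr ?sqr_ge0//.
by have := expR_ge1Dx `|u|; have := normr_ge0 u; lra.
Qed.

Lemma sqr_le_expR (y : R) : 0 <= y -> y ^+ 2 <= 32 * expR (y / 4).
Proof.
move=> y0; have y4 : 0 <= y / 4 by lra.
by have := expR_ge1Dxn 1 y4; rewrite (_ : 2`!%:R = 2 :> R)//; lra.
Qed.

(** Second-order expansion of [exp (- h y)]. The remainder [h^2 y^2 exp (|h| y)] is at most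
    [32 h^2 exp (3 y / 4)], from [|h| <= 1/2] and [y^2 <= 32 exp (y / 4)]; against [exp (- y)] this
    leaves the integrable [exp (- y / 4)]. *)
Lemma kernel_quad p t (h x : R) : 1 < p -> `|h| <= 2^-1 ->
  expR (t * x - (1 + h) * yp p x) <=
  expR (t * x - 1 * yp p x) + - h * (yp p x * expR (t * x - 1 * yp p x))
    + (32 * h ^+ 2) * expR (t * x - 4^-1 * yp p x).
Proof.
move=> p1 hh; have p0 : 0 < p by lra.
have y0 := yp_ge0 x p0; set y := yp p x in y0 *.
pose w := expR (t * x - 1 * y).
have w0 : 0 < w by exact: expR_gt0.
have -> : expR (t * x - (1 + h) * y) = w * expR (- (h * y)).
  by rewrite /w -expRD; congr expR; ring.
have -> : expR (t * x - 4^-1 * y) = w * expR (3 / 4 * y).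
  by rewrite /w -expRD; congr expR; field.
apply: (@le_trans _ _ (w * (1 - h * y + 32 * h ^+ 2 * expR (3 / 4 * y)))); last first.
  by rewrite le_eqVlt; apply/orP; left; apply/eqP; rewrite /w; ring.
rewrite ler_wpM2l ?(ltW w0)// (le_trans (expR_le_quad _))//.
rewrite -[1 + - _]/(1 - h * y) lerD2l sqrrN exprMn.
apply: (@le_trans _ _ (h ^+ 2 * (y ^+ 2 * expR (y / 2)))).
  rewrite -mulrA ler_wpM2l ?sqr_ge0// ler_wpM2l ?sqr_ge0// ler_expR normrN normrM.
  by rewrite (ger0_norm y0) mulrC ler_wpM2l.
rewrite (mulrC 32) -[leRHS]mulrA ler_wpM2l ?sqr_ge0//.
have -> : expR (3 / 4 * y) = expR (y / 4) * expR (y / 2).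
  by rewrite -expRD; congr expR; field.
by rewrite mulrA ler_wpM2r ?expR_ge0 ?sqr_le_expR.
Qed.

Lemma integrable_yp_kernel p t : 1 < p ->
  mu.-integrable setT (EFin \o (fun x => yp p x * expR (t * x - 1 * yp p x))).
Proof.
move=> p1; have p0 : 0 < p by lra.
apply: (@integrable_kernel_bound p _ 2 `|t| 2^-1) => //.
  by apply: measurable_funM; [exact: measurable_yp | exact: measurable_expR_kernel].
move=> x; have y0 := yp_ge0 x p0.
rewrite ger0_norm; last by apply: mulr_ge0 => //; exact: expR_ge0.
apply: (@le_trans _ _ (2 * expR (yp p x / 2) * expR (t * x - 1 * yp p x))).
  rewrite ler_wpM2r ?expR_ge0//.
  by have := expR_ge1Dx (yp p x / 2); lra.
rewrite -mulrA -expRD ler_wpM2l// ler_expR.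
by have := ler_norm (t * x); rewrite normrM; lra.
Qed.

(** The number [a] is the mean of [yp p] under the tilt [t]. Integrate [kernel_quad], divide by
    [kint p t 1] and use [1 + x <= exp x]. A one-sided quadratic bound is all that Chernoff's method
    asks for. *)
Lemma kint_quad p t : 1 < p -> exists a C : R, [/\ 0 < a, 0 <= C &
  forall h, `|h| <= 2^-1 -> kint p t (1 + h) <= kint p t 1 * expR (- h * a + C * h ^+ 2)].
Proof.
move=> p1; have p0 : 0 < p by lra.
have k0 := kint_gt0 t p1 ltr01; have k4 : 0 < kint p t 4^-1 by exact: kint_gt0.
pose A := \int[mu]_x (yp p x * expR (t * x - 1 * yp p x)).
have A0 : 0 < A.
  suff : (0 < \int[mu]_x (yp p x * expR (t * x - 1 * yp p x))%:E)%E.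
    move=> h; rewrite -lte_fin /A /Rintegral fineK//.
    by apply: integrable_fin_num => //; exact: integrable_yp_kernel.
  apply: (@integral_itv12_gt0 _ (p^-1 * expR (- (`|t| * 2) - 1 * (2 `^ p / p)))).
  - by rewrite mulr_gt0 ?invr_gt0 ?expR_gt0.
  - by move=> x; rewrite mulr_ge0 ?expR_ge0 ?yp_ge0.
  - move=> x x12; apply: ler_pM; rewrite ?invr_ge0 ?(ltW p0) ?expR_ge0 ?kernel_ge_itv12//.
    move: x12 => /andP[x1 _]; rewrite /yp -[leLHS]mul1r ler_wpM2r ?invr_ge0 ?(ltW p0)//.
    have x0 : 0 <= x by lra.
    by rewrite (ger0_norm x0) (le_trans x1)// le1r_powR// ltW.
exists (A / kint p t 1), (32 * (kint p t 4^-1 / kint p t 1)); split.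
- by rewrite divr_gt0.
- by apply: mulr_ge0 => //; apply: divr_ge0; exact: ltW.
move=> h hh.
have h1 : 0 < 1 + h by move: hh; rewrite ler_norml; lra.
have step : kint p t (1 + h) <= kint p t 1 + - h * A + 32 * h ^+ 2 * kint p t 4^-1.
  pose f1 (x : R) := expR (t * x - 1 * yp p x).
  pose f4 (x : R) := expR (t * x - 4^-1 * yp p x).
  pose fY (x : R) := yp p x * f1 x.
  have i1 : mu.-integrable setT (EFin \o f1) by exact: integrable_expR_kernel.
  have i4 : mu.-integrable setT (EFin \o f4) by exact: integrable_expR_kernel.
  have iY : mu.-integrable setT (EFin \o fY) by exact: integrable_yp_kernel.
  have iZ : mu.-integrable setT (EFin \o (fun x => - h * fY x)).
    exact: (integrableZl measurableT (- h) iY).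
  have iQ : mu.-integrable setT (EFin \o (fun x => 32 * h ^+ 2 * f4 x)).
    exact: (integrableZl measurableT (32 * h ^+ 2) i4).
  have iS : mu.-integrable setT (EFin \o (fun x => f1 x + - h * fY x)).
    exact: (integrableD measurableT i1 iZ).
  have iT : mu.-integrable setT
      (EFin \o (fun x => (f1 x + - h * fY x) + 32 * h ^+ 2 * f4 x)).
    exact: (integrableD measurableT iS iQ).
  have -> : kint p t 1 + - h * A + 32 * h ^+ 2 * kint p t 4^-1 =
      \int[mu]_x ((f1 x + - h * fY x) + 32 * h ^+ 2 * f4 x).
    by rewrite kint.unlock (RintegralD measurableT iS iQ) (RintegralD measurableT i1 iZ)
      (RintegralZl (- h) measurableT iY) (RintegralZl _ measurableT i4).
  rewrite kint.unlock; apply: le_Rintegral => //.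
    exact: integrable_expR_kernel.
  by move=> x _; exact: kernel_quad.
apply: (le_trans step).
rewrite (_ : _ + _ + _ = kint p t 1 * (1 + (- h * (A / kint p t 1) +
    32 * (kint p t 4^-1 / kint p t 1) * h ^+ 2))).
  by rewrite ler_wpM2l ?(ltW k0)// expR_ge1Dx.
by move: k0; move: (kint p t 1) (kint p t 4^-1) => u v u0; field; rewrite gt_eqF.
Qed.

(** Dominated convergence, with the tilts bounded by [|t| + 1] near [t]. *)
Lemma continuous_kint p : 1 < p -> continuous (fun t => kint p t 1).
Proof.
move=> p1 t; rewrite kint.unlock.
pose T := `|t| + 1.
have tI : t \in `]- T, T[ by rewrite in_itv/= -ltr_norml /T ltrDl.
have itvT (u : R) : `]- T, T[%classic u -> `|u| <= T.
  by rewrite /= in_itv/= -ltr_norml => /ltW.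
apply: (@continuity_under_integral R _ _ mu
  (fun l x => expR (l * x - 1 * yp p x)) setT measurableT (- T) T _ _
  (fun x => expR (T * `|x| - 1 * yp p x))).
- by move=> x _; exact: integrable_expR_kernel.
- apply/aeW => y _ x _; apply: continuous_comp; last exact: continuous_expR.
  apply: (@continuousB _ R^o); last exact: cst_continuous.
  by apply: (@continuousM _ R^o) => //; exact: cst_continuous.
- apply: (@integrable_kernel_bound p _ 1 T 1) => //.
    apply: measurableT_comp; first exact: measurable_expR.
    apply: measurable_funB.
      by apply: measurable_funM => //; exact: normr_measurable.
    by apply: measurable_funM => //; exact: measurable_yp.
  by move=> x; rewrite [leRHS]mul1r ger0_norm ?expR_ge0.
- move=> l /itvT lT; apply/aeW => x _; rewrite ger0_norm ?expR_ge0// ler_expR.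
  rewrite lerD2r (le_trans (ler_norm _))// normrM ler_wpM2r//.
- by rewrite inE.
Qed.

End ExponentialIntegrals.

(** * The log-moment generating function and the functional [Phi] *)

HB.lock Definition lmgf {R : realType} (p t : R) : R := psi p t.

Section LogMgf.
Set Implicit Arguments. Unset Strict Implicit.
Context {R : realType}.
Implicit Types p t s r : R.
Local Notation mu := (@lebesgue_measure R).

Lemma Gamma_1D_gt0 (e : R) : 0 < e -> e <= 1 -> 0 < Gamma (1 + e).
Proof.
move=> e0 e1; rewrite /Gamma addrAC subrr add0r.
pose f (x : R) := x `^ e * expR (- x).
pose D := [set x : R | 0 < x].
have fD (x : R) : (((EFin \o f) \_ D) x = ((f \_ D) x)%:E)%E by rewrite !patchE; case: ifP.
have fD0 x : 0 <= (f \_ D) x.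
  by rewrite patchE; case: ifP => // _; rewrite mulr_ge0 ?powR_ge0 ?expR_ge0.
rewrite -[X in fine X]/(integral mu D (EFin \o f)) integral_mkcond.
apply: fine_gt0; apply/andP; split.
  under eq_integral do rewrite fD.
  apply: (@integral_itv12_gt0 _ _ (expR (- 2))); [exact: expR_gt0|exact: fD0|].
  move=> x /andP[x1 x2]; rewrite patchE ifT; last by rewrite inE /D/=; lra.
  rewrite /f -[leLHS]mul1r ler_pM ?expR_ge0 ?ler_expR ?lerN2//.
  by rewrite -(powRr0 x) ler_powR// ltW.
have h0 : 0 < 2^-1 :> R by rewrite invr_gt0.
(* Finiteness matters: [fine] sends [+oo] to 0, which would destroy positivity. The bound used is
   [x^e <= 1 + x <= 2 exp (x / 2)]. *)
have /integrableP[_] := integrableZl measurableT 2 (integrable_expRN_normr h0).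
apply: le_lt_trans; apply: le_integral_nonneg => x.
  by rewrite fD lee_fin.
rewrite fD /= lee_fin ger0_norm ?mulr_ge0 ?expR_ge0// patchE.
case: ifPn => [|_]; last by rewrite mulr_ge0 ?expR_ge0.
rewrite inE /D /= => x0; rewrite /f (gtr0_norm x0).
have -> : expR (- (2^-1 * x)) = expR (x / 2) * expR (- x).
  by rewrite -expRD; congr expR; field.
rewrite mulrA ler_wpM2r ?expR_ge0//.
have h : x `^ e <= 1 + x.
  have [x1|x1] := leP 1 x; first by rewrite (le_trans (ler1_powR x1 e1))//; lra.
  have : x `^ e <= x `^ 0 by apply: ger_powR; rewrite ?(ltW e0)// x0 ltW.
  by rewrite powRr0; lra.
by have := expR_ge1Dx (x / 2); lra.
Qed.

Lemma c_p_gt0 p : 1 < p -> 0 < c_p p.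
Proof.
move=> p1; have p0 : 0 < p by lra.
rewrite divr_gt0 ?powR_gt0// mulr_gt0// Gamma_1D_gt0 ?invr_gt0//.
by rewrite invf_le1// ltW.
Qed.

Lemma lmgfE p t : 1 < p -> lmgf p t = ln (c_p p * kint p t 1).
Proof.
move=> p1; rewrite lmgf.unlock /psi -[c_p p * _]/(fine (c_p p * kint p t 1)%:E).
congr (ln (fine _)).
transitivity (\int[mu]_x ((c_p p)%:E * (expR (t * x - 1 * yp p x))%:E))%E.
  apply: eq_integral => x _.
  by rewrite -EFinM /rho mulrCA -expRD mul1r /yp mulNr.
rewrite ge0_integralZl_EFin//.
- by rewrite kintE.
- by apply/measurable_EFinP; exact: measurable_expR_kernel.
- by rewrite ltW// c_p_gt0.
Qed.

Lemma expR_lmgf p t : 1 < p -> expR (lmgf p t) = c_p p * kint p t 1.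
Proof.
by move=> p1; rewrite lmgfE// lnK// posrE mulr_gt0 ?c_p_gt0 ?kint_gt0.
Qed.

Lemma lmgfN p t : 1 < p -> lmgf p (- t) = lmgf p t.
Proof.
by move=> p1; rewrite (lmgfE (- t) p1) (lmgfE t p1) (kintN t p1 ltr01).
Qed.

Lemma lmgf_min p t : 1 < p -> lmgf p 0 <= lmgf p t.
Proof.
move=> p1; rewrite -ler_expR (expR_lmgf 0 p1) (expR_lmgf t p1).
by apply: ler_wpM2l; [exact: ltW (c_p_gt0 p1)|exact: kint_min].
Qed.

Lemma continuous_lmgf p : 1 < p -> continuous (lmgf p).
Proof.
move=> p1; have -> : lmgf p = fun t => ln (c_p p * kint p t 1).
  by apply/funext => t; exact: lmgfE.
move=> t; apply: continuous_comp; last first.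
  by apply: continuous_ln; rewrite mulr_gt0 ?c_p_gt0 ?kint_gt0.
by apply: (@continuousM _ R^o); [exact: cst_continuous|exact: continuous_kint].
Qed.

Definition Phi p s r : R := lmgf p (s / r) + (r `^ p - 1) / p - ln r.

(* Forces [r ^ p] to be the mean of [|X| ^ p] under the exponential tilt [exp (t X)]. *)
Definition tilted p t r := 0 < r /\ exists2 C : R, 0 <= C &
  forall h, `|h| <= 2^-1 ->
    kint p t (1 + h) <= kint p t 1 * expR (- h * (r `^ p / p) + C * h ^+ 2).

Lemma ex_tilted p t : 1 < p -> exists r, tilted p t r.
Proof.
move=> p1; have p0 : 0 < p by lra.
have [a [C [a0 C0 H]]] := kint_quad t p1.
exists ((p * a) `^ p^-1); split; first by rewrite powR_gt0// mulr_gt0.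
exists C => // h /H.
rewrite -powRrM mulVf ?gt_eqF// powRr1 ?mulr_ge0 ?(ltW p0) ?(ltW a0)//.
by rewrite mulrAC divff ?gt_eqF// mul1r.
Qed.

(** A linear function lying below a quadratic near 0 has slope 0. It serves as the first-order
    condition at a minimizer, with no derivative of [kint] computed. *)
Lemma quad_touch_eq0 (d C : R) : 0 <= C ->
  (forall h, `|h| <= 2^-1 -> h * d <= C * h ^+ 2) -> d = 0.
Proof.
move=> C0 H; apply/eqP; rewrite -normr_le0 leNgt; apply/negP => d0.
pose e := Num.min 2^-1 (`|d| / (2 * (C + 1))).
have C1 : 0 < 2 * (C + 1) by lra.
have e0 : 0 < e by rewrite lt_min invr_gt0 ltr0n divr_gt0.
have ee : e <= 2^-1 by rewrite ge_min lexx.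
have ed : e * (2 * (C + 1)) <= `|d| by rewrite -ler_pdivlMr// ge_min lexx orbT.
have dCe : `|d| <= C * e.
  rewrite -(ler_pM2l e0) mulrCA -expr2; have [dp|dn] := leP 0 d.
    by rewrite (ger0_norm dp); apply: H; rewrite (gtr0_norm e0).
  rewrite (ltr0_norm dn).
  by have := H (- e); rewrite normrN (gtr0_norm e0) sqrrN mulNr -mulrN; apply.
have : C * e <= e * (C + 1) by rewrite mulrDr mulr1 mulrC lerDl ltW.
by nra.
Qed.

Lemma continuous_Phi p s r : 1 < p -> 0 < r -> {for r, continuous (Phi p s)}.
Proof.
move=> p1 r0; rewrite /Phi.
apply: cvgB; last exact: continuous_ln.
apply: cvgD.
  apply: (@continuous_comp _ _ _ (fun r => s / r) (lmgf p)).
    by apply: cvgM; [exact: cvg_cst|apply: cvgV; rewrite ?gt_eqF].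
  exact: continuous_lmgf.
apply: cvgM; last exact: cvg_cst.
apply: cvgB; last exact: cvg_cst.
have d : derivable ((powR (R:=R))^~ p) r 1 by apply: derivable_powR; rewrite in_itv/= r0.
exact: (@differentiable_continuous R R^o R^o r ((powR (R:=R))^~ p) ((derivable1_diffP _ _).1 d)).
Qed.

(** Outside a compact interval [[m, M]] containing 1, [Phi p s] is at least its value at 1; on the
    interval the extreme value theorem applies. *)
Lemma ex_minimizer p s : 1 < p ->
  exists2 r0, 0 < r0 & forall r, 0 < r -> Phi p s r0 <= Phi p s r.
Proof.
move=> p1; have p0 : 0 < p by lra.
have pn0 : p != 0 by rewrite gt_eqF.
pose D := lmgf p s - lmgf p 0.
have D0 : 0 <= D by rewrite subr_ge0 lmgf_min.
have Phi1 : Phi p s 1 = lmgf p s.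
  by rewrite /Phi divr1 ln1 powR1 subrr mul0r addr0 subr0.
(* For [r < m] the term [- ln r] exceeds [D + 1/p], which pays for [(r^p - 1) / p >= - 1/p] and for
   replacing [lmgf p (s / r)] by [lmgf p 0]. *)
pose m := expR (- (D + p^-1)).
have m0 : 0 < m by exact: expR_gt0.
have m1 : m <= 1 by rewrite expR_le1 oppr_le0 addr_ge0// invr_ge0 ltW.
(* With [ln (r^p) <= r^p / 2], the gap is at least [(r^p / 2 - 1) / p], which reaches [D] once
   [r^p >= 2 p D + 2]. *)
pose v := 2 * p * D + 2.
have v0 : 1 <= v by have : 0 <= 2 * p * D; [rewrite !mulr_ge0// ltW|rewrite /v; lra].
pose M := v `^ p^-1.
have M1 : 1 <= M.
  by rewrite /M -(powRr0 v) ler_powR// invr_ge0 ltW.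
have small r : 0 < r -> r < m -> lmgf p s <= Phi p s r.
  move=> r0 rm; have := lmgf_min (s / r) p1.
  have : ln r <= - (D + p^-1).
    by rewrite -ler_expR lnK ?posrE// ltW.
  have : - p^-1 <= (r `^ p - 1) / p.
    by rewrite -[leLHS]mulN1r ler_wpM2r ?invr_ge0 ?(ltW p0)// lerDr powR_ge0.
  rewrite /Phi /D; lra.
have large r : M < r -> lmgf p s <= Phi p s r.
  move=> Mr; have r0 : 0 < r by lra.
  have := lmgf_min (s / r) p1.
  have vr : v <= r `^ p.
    have -> : v = M `^ p by rewrite /M -powRrM mulVf// powRr1//; lra.
    by apply: ge0_ler_powR; rewrite ?nnegrE ?(ltW p0) ?(ltW r0)// ltW//; lra.
  have lnr : ln r = ln (r `^ p) / p by rewrite ln_powR mulrAC divff// mul1r.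
  have : ln (r `^ p) <= r `^ p / 2.
    have r2 : 0 < r `^ p / 2 by rewrite divr_gt0 ?powR_gt0.
    have h1 : ln (r `^ p / 2) <= r `^ p / 2 - 1.
      have := @le_ln1Dx R (r `^ p / 2 - 1).
      by rewrite (_ : 1 + (_ - 1) = r `^ p / 2); [apply; lra|ring].
    have h2 : ln 2 <= 1 :> R.
      by have := @le_ln1Dx R 1; rewrite (_ : 1 + 1 = 2)//; apply; lra.
    rewrite ln_div ?posrE ?powR_gt0// in h1; lra.
  move=> h; have : D <= (r `^ p - 1) / p - ln (r `^ p) / p.
    by rewrite -mulrBl ler_pdivlMr// /v in vr *; lra.
  rewrite /Phi lnr /D; lra.
have mM : m <= M by lra.
have cPhi : {within `[m, M], continuous (Phi p s)}.
  apply: continuous_in_subspaceT => r; rewrite inE/= in_itv/= => /andP[mr rM].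
  have r0 : 0 < r by lra.
  exact: continuous_Phi.
have [r0 r0I r0min] := EVT_min mM cPhi.
move: r0I; rewrite in_itv/= => /andP[mr0 r0M].
exists r0; first by lra.
have le1 : Phi p s r0 <= lmgf p s.
  by rewrite -Phi1; apply: r0min; rewrite in_itv/= m1.
move=> r rp; have [rm|mr] := ltP r m; first exact: le_trans (small _ rp rm).
have [Mr|rM] := ltP M r; first exact: le_trans (large _ Mr).
by apply: r0min; rewrite in_itv/= mr.
Qed.

(** At a minimizer [r] of [Phi p s], minimality and scaling bound [ln (kint p (s / r) (1 + h))]
    below by a line of slope [- r^p / p], while [kint_quad] bounds it above by a parabola of slope
    [- a] touching at [h = 0]. Hence [r^p / p = a]. *)
Lemma ex_tilted_div p s : 1 < p -> exists r, tilted p (s / r) r.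
Proof.
move=> p1; have p0 : 0 < p by lra.
have pn0 : p != 0 by rewrite gt_eqF.
have [r r0 rmin] := ex_minimizer s p1.
have [a [C [a0 C0 H]]] := kint_quad (s / r) p1.
exists r; split => //; exists C => // h hh.
suff -> : r `^ p / p = a by exact: H.
apply/eqP; rewrite -subr_eq0 -oppr_eq0 opprB; apply/eqP.
apply: (quad_touch_eq0 C0) => {hh}h hh.
have h1 : 0 < 1 + h by move: hh; rewrite ler_norml; lra.
have k0 := kint_gt0 (s / r) p1 ltr01.
have kh := kint_gt0 (s / r) p1 h1.
have := H h hh; rewrite -ler_ln ?posrE ?mulr_gt0 ?expR_gt0//.
rewrite lnM ?posrE ?expR_gt0// expRK kint_scale// lnM ?posrE ?powR_gt0 ?kint_gt0//.
rewrite ln_powR.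
(* This perturbation of [r] matches the scaling of [kint] from [c = 1 + h] to [c = 1], so the terms
   in [ln (1 + h)] cancel. *)
pose r' := r * (1 + h) `^ p^-1.
have hp : 0 < (1 + h) `^ p^-1 by rewrite powR_gt0.
have r'0 : 0 < r' by rewrite mulr_gt0.
have lr' : ln r' = ln r + p^-1 * ln (1 + h) by rewrite lnM ?posrE// ln_powR.
have ll t : lmgf p t = ln (c_p p) + ln (kint p t 1).
  by rewrite lmgfE// lnM ?posrE ?c_p_gt0 ?kint_gt0.
have := rmin _ r'0; rewrite /Phi !ll lr'.
rewrite (_ : s / r' = s / r * (1 + h) `^ (- p^-1)); last first.
  by rewrite powRN /r' invfM mulrA.
have -> : r' `^ p = r `^ p * (1 + h).
  by rewrite /r' powRM ?(ltW r0) ?(ltW hp)// -powRrM mulVf// powRr1 ?(ltW h1).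
move: (ln (kint _ _ _)) (ln (kint _ _ _)) (ln (c_p p)) (ln (1 + h)) => x1 x2 x3 x4.
have -> : (r `^ p * (1 + h) - 1) / p = (r `^ p - 1) / p + h * (r `^ p / p) by field.
lra.
Qed.

End LogMgf.

(** * Chernoff bounds for the empirical p-th moment *)

Section Concentration.
Set Implicit Arguments. Unset Strict Implicit.
Context {R : realType}.
Implicit Types p t s r : R.

(** [b.2 / (n p)] is the empirical mean of [yp p] over the coordinates. *)
Definition window n p (a delta : R) (b : R * R) : R :=
  if `|b.2 / (n%:R * p) - a| < delta then 1 else 0.

Lemma window_ge0 n p a delta b : 0 <= window n p a delta b.
Proof. by rewrite /window; case: ifP. Qed.

Lemma measurable_window n p a delta : measurable_fun setT (window n p a delta).
Proof.
apply: measurable_fun_ifT => //.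
apply: measurable_fun_ltr => //; apply: measurableT_comp; first exact: normr_measurable.
by apply: measurable_funB => //; apply: measurable_funM.
Qed.

Lemma measurable_expR_snd (c p : R) :
  measurable_fun setT (fun b : R * R => expR (- (c * b.2 / p))).
Proof.
apply: measurableT_comp; first exact: measurable_expR.
apply: measurableT_comp; first exact: oppr_measurable.
by apply: measurable_funM => //; apply: measurable_funM.
Qed.

Lemma nneg_meas_EFin (f : R * R -> R) : measurable_fun setT f ->
  (forall b, 0 <= f b) -> nneg_meas (EFin \o f).
Proof.
by move=> mf f0; split=> [|b]; [exact/measurable_EFinP|rewrite lee_fin].
Qed.

Lemma near_expRM_ge (e M : R) : 0 < e -> \forall n \near \oo, M <= expR (n%:R * e).
Proof.
move=> e0; near=> n.
have : M / e <= n%:R by near: n; exact: nbhs_infty_ger.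
rewrite ler_pdivrMr// => h; have := expR_ge1Dx (n%:R * e); lra.
Unshelve. all: by end_near. Qed.

(** Exponential Markov at [1 - h] and [1 + h] bounds the mass of each tail by a quarter of the total
    [L 1], so the window carries at least half. The threshold on [n] is uniform in [W], [L] and [a],
    because the weights to which this is applied depend on [n]. *)
Lemma chernoff_window p (C delta : R) : 0 < p -> 0 <= C -> 0 < delta ->
  \forall n \near \oo, forall (W : R * R -> R) (L : R -> R) (a : R),
    measurable_fun setT W -> (forall b, 0 <= W b) ->
    (forall h, `|h| <= 2^-1 ->
      stint p n (fun b => (W b * expR (- ((1 + h) * b.2 / p)))%:E) (0, 0) = (L (1 + h))%:E) ->
    (forall h, `|h| <= 2^-1 -> L (1 + h) <= L 1 * expR (n%:R * (- h * a + C * h ^+ 2))) ->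
  ((L 1)%:E <= 2%:E *
    stint p n (fun b => (W b * expR (- (1 * b.2 / p)) * window n p a delta b)%:E) (0, 0)%R)%E.
Proof.
move=> p0 C0 delta0.
(* Makes [C h <= delta / 2], so the exponent [C h^2 - h delta] is at most [- h delta / 2]. *)
pose h := Num.min 2^-1 (delta / (2 * (C + 1))).
have C1 : 0 < 2 * (C + 1) by lra.
have h0 : 0 < h by rewrite lt_min invr_gt0 ltr0n divr_gt0.
have h2 : `|h| <= 2^-1 by rewrite gtr0_norm// ge_min lexx.
have hC : h * (2 * (C + 1)) <= delta by rewrite -ler_pdivlMr// ge_min lexx orbT.
have e0 : 0 < h * delta / 2 by rewrite divr_gt0// mulr_gt0.
have he : C * h ^+ 2 - h * delta <= - (h * delta / 2).
  have : C * h <= delta / 2 by lra.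
  by rewrite expr2 mulrA => /(ler_wpM2r (ltW h0)); lra.
near=> n => W L a mW W0 hI hL.
have n0 : 0 < n%:R :> R by near: n; exact: nbhs_infty_gtr.
have small : expR (n%:R * (C * h ^+ 2 - h * delta)) <= 4^-1.
  apply: (@le_trans _ _ (expR (n%:R * - (h * delta / 2)))).
    by rewrite ler_expR ler_pM2l.
  rewrite mulrN expRN lef_pV2 ?posrE ?expR_gt0//.
  by near: n; exact: near_expRM_ge.
have L0 : 0 <= L 1.
  have : `|0 : R| <= 2^-1 by rewrite normr0 invr_ge0.
  move=> /hI; rewrite addr0 => hI0; rewrite -lee_fin -hI0.
  apply: (nneg_meas_stint p n _).2; apply: nneg_meas_EFin => [|b].
    by apply: measurable_funM => //; exact: measurable_expR_snd.
  by rewrite mulr_ge0 ?expR_ge0.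
pose f c (b : R * R) := W b * expR (- (c * b.2 / p)).
have f0 c b : 0 <= f c b by rewrite mulr_ge0 ?expR_ge0.
have mf c : measurable_fun setT (f c).
  by apply: measurable_funM => //; exact: measurable_expR_snd.
pose g b := f 1 b * window n p a delta b.
have g0 b : 0 <= g b by rewrite mulr_ge0 ?window_ge0.
have mg : measurable_fun setT g by apply: measurable_funM => //; exact: measurable_window.
set J := stint _ _ _ _.
have J0 : (0 <= J)%E by apply: (nneg_meas_stint p n _).2; exact: nneg_meas_EFin.
pose k1 := expR (- (n%:R * h * (a + delta))).
pose k2 := expR (n%:R * h * (a - delta)).
have hIm : stint p n (EFin \o f (1 - h)) (0, 0) = (L (1 - h))%:E by apply: hI; rewrite normrN.
have hIp : stint p n (EFin \o f (1 + h)) (0, 0) = (L (1 + h))%:E by exact: hI.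
have hI1 : stint p n (EFin \o f 1) (0, 0) = (L 1)%:E.
  by have := hI 0; rewrite addr0 normr0; apply; rewrite invr_ge0.
(* Pointwise, 1 is at most the window indicator plus [exp (h (b.2 / p - n (a + delta)))] plus
   [exp (- h (b.2 / p - n (a - delta)))]. *)
have key : ((L 1)%:E <= J + (k1 * L (1 - h) + k2 * L (1 + h))%:E)%E.
  have ng := nneg_meas_EFin mg g0.
  have nm := nneg_meas_EFin (mf (1 - h)) (f0 _).
  have np := nneg_meas_EFin (mf (1 + h)) (f0 _).
  have k10 : 0 <= k1 by exact: expR_ge0.
  have k20 : 0 <= k2 by exact: expR_ge0.
  have nzm : nneg_meas (fun b => k1%:E * (EFin \o f (1 - h)%R) b)%E.
    apply: (@nneg_meas_EFin (fun b => k1 * f (1 - h) b)); first exact: measurable_funM.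
    by move=> b; rewrite mulr_ge0.
  have nzp : nneg_meas (fun b => k2%:E * (EFin \o f (1 + h)%R) b)%E.
    apply: (@nneg_meas_EFin (fun b => k2 * f (1 + h) b)); first exact: measurable_funM.
    by move=> b; rewrite mulr_ge0.
  have nz : nneg_meas (fun b => k1%:E * (EFin \o f (1 - h)%R) b + k2%:E * (EFin \o f (1 + h)%R) b)%E.
    apply: (@nneg_meas_EFin (fun b => k1 * f (1 - h) b + k2 * f (1 + h) b)).
      by apply: measurable_funD; exact: measurable_funM.
    by move=> b; rewrite addr_ge0 ?mulr_ge0.
  rewrite -hI1 EFinD !EFinM -hIm -hIp -(stintZ p n _ k10 nm) -(stintZ p n _ k20 np).
  rewrite -(stintD p n _ nzm nzp) -(stintD p n _ ng nz).
  apply: stint_le => [b|l _]; first by rewrite lee_fin.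
  set b := foldl _ _ _; rewrite /= -!EFinM -!EFinD lee_fin /g.
  have -> : k1 * f (1 - h) b = f 1 b * expR (h * (b.2 / p - n%:R * (a + delta))).
    rewrite /f /k1 mulrCA -[RHS]mulrA -!expRD; congr (_ * expR _); ring.
  have -> : k2 * f (1 + h) b = f 1 b * expR (- h * (b.2 / p - n%:R * (a - delta))).
    rewrite /f /k2 mulrCA -[RHS]mulrA -!expRD; congr (_ * expR _); ring.
  rewrite -!mulrDr -[leLHS]mulr1 ler_wpM2l//.
  set e1 := expR _; set e2 := expR _.
  have e10 : 0 < e1 by exact: expR_gt0.
  have e20 : 0 < e2 by exact: expR_gt0.
  rewrite /window; case: ifPn => [_|]; first lra.
  rewrite -leNgt add0r => hw.
  have hb : b.2 / (n%:R * p) = b.2 / p / n%:R by field; rewrite !gt_eqF.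
  move: hw; rewrite hb; have [hp|hn] := leP 0 (b.2 / p / n%:R - a).
    rewrite ger0_norm// => hw; suff : 1 <= e1 by lra.
    rewrite -(expR0) ler_expR mulr_ge0// ?(ltW h0)// subr_ge0 mulrC -ler_pdivlMr//; lra.
  rewrite ltr0_norm// => hw; suff : 1 <= e2 by lra.
  rewrite -(expR0) ler_expR mulNr oppr_ge0 mulr_ge0_le0 ?(ltW h0)// subr_le0 [leRHS]mulrC -ler_pdivrMr//; lra.
have b1 : k1 * L (1 - h) <= L 1 * 4^-1.
  have h2' : `|- h| <= 2^-1 by rewrite normrN.
  have /(ler_wpM2l (expR_ge0 (- (n%:R * h * (a + delta))))) := hL (- h) h2'.
  move/le_trans; apply; rewrite mulrCA ler_wpM2l// -expRD (le_trans _ small)// ler_expR.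
  by rewrite sqrrN le_eqVlt; apply/orP; left; apply/eqP; ring.
have b2 : k2 * L (1 + h) <= L 1 * 4^-1.
  have /(ler_wpM2l (expR_ge0 (n%:R * h * (a - delta)))) := hL h h2.
  move/le_trans; apply; rewrite mulrCA ler_wpM2l// -expRD (le_trans _ small)// ler_expR.
  by rewrite le_eqVlt; apply/orP; left; apply/eqP; ring.
move: J J0 key => [j| |] // J0 key; last by rewrite gt0_muley ?leey// lte_fin.
by move: key; rewrite -EFinM -EFinD !lee_fin; lra.
Unshelve. all: by end_near. Qed.

End Concentration.

(** * Exponential moments on the sphere *)

Section SphericalAverages.
Set Implicit Arguments. Unset Strict Implicit.
Context {R : realType}.
Implicit Types p t s r : R.
Local Notation mu := (@lebesgue_measure R).

(* [exp (s n m)] in terms of [b = (sum x_i, sum |x_i|^p)], with value 0 at the origin. *)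
Definition sphexp p n s (b : R * R) : R :=
  if 0 < b.2 then expR (s * b.1 / (b.2 / n%:R) `^ p^-1) else 0.

Lemma sphexp_ge0 p n s b : 0 <= sphexp p n s b.
Proof. by rewrite /sphexp; case: ifP => // _; exact: expR_ge0. Qed.

Lemma measurable_sphexp p n s : measurable_fun setT (sphexp p n s).
Proof.
apply: measurable_fun_ifT => //.
  by apply: measurable_fun_ltr.
apply: measurableT_comp; first exact: measurable_expR.
apply: measurable_funM; first exact: measurable_funM.
under eq_fun do rewrite -powRN.
apply: (measurableT_comp (measurable_powR _)).
exact: measurable_funM.
Qed.

Lemma sphexp_scale p n s (l : R) b : 0 < p -> 0 < l ->
  sphexp p n s (l * b.1, l `^ p * b.2) = sphexp p n s b.
Proof.
move=> p0 l0; have lp0 : 0 < l `^ p by rewrite powR_gt0.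
rewrite /sphexp [(l * _, _).1]/= [(l * _, _).2]/= (pmulr_rgt0 _ lp0).
case b0 : (0 < b.2); last exact: erefl.
have bn0 : 0 <= b.2 / n%:R by rewrite divr_ge0// ltW.
have -> : (l `^ p * b.2 / n%:R) `^ p^-1 = l * (b.2 / n%:R) `^ p^-1.
  rewrite -mulrA (powRM _ (ltW lp0) bn0) -powRrM mulfV ?gt_eqF//.
  by rewrite powRr1// ltW.
rewrite invfM; move: (_ `^ _)^-1 => v; congr expR.
have ll : l * l^-1 = 1 by rewrite divff ?gt_eqF.
transitivity (s * b.1 * v * (l * l^-1)); first by ring.
by rewrite ll mulr1.
Qed.

(** Young's inequality with second factor 1: the convex function [u^p / p] lies above its tangent at
    1. *)
Lemma tangent_powR p (u : R) : 1 < p -> 0 <= u -> u <= u `^ p / p + (1 - p^-1).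
Proof.
move=> p1 u0; have p0 : 0 < p by lra.
pose q := p / (p - 1).
have q0 : 0 < q by rewrite divr_gt0// subr_gt0.
have qE : q^-1 = 1 - p^-1 by rewrite /q invf_div; field; rewrite gt_eqF.
have := @conjugate_powR R u 1 p q u0 ler01 p0 q0.
by rewrite qE mulr1 powR1 mul1r addrC subrK; apply.
Qed.

(** Sum the tangent inequality at [u = |x| / rho]: the right-hand sides add up to
    [n / p + n (1 - 1/p) = n]. *)
Lemma power_mean p (l : seq R) : 1 < p -> 0 < \sum_(x <- l) `|x| `^ p ->
  \sum_(x <- l) `|x| <=
  (size l)%:R * ((\sum_(x <- l) `|x| `^ p) / (size l)%:R) `^ p^-1.
Proof.
move=> p1; set N := \sum_(x <- l) `|x| `^ p => N0; have p0 : 0 < p by lra.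
have n0 : 0 < (size l)%:R :> R.
  rewrite ltr0n lt0n; apply: contraTneq N0 => /size0nil l0.
  by rewrite /N l0 big_nil ltxx.
set rho := _ `^ p^-1.
have rho0 : 0 < rho by rewrite powR_gt0// divr_gt0.
have rhop : rho `^ p = N / (size l)%:R.
  by rewrite /rho -powRrM mulVf ?gt_eqF// powRr1// ltW// divr_gt0.
rewrite -ler_pdivrMr// mulr_suml.
apply: (@le_trans _ _ (\sum_(x <- l) (`|x| `^ p * (rho `^ p)^-1 / p + (1 - p^-1)))).
  apply: ler_sum => x _; have x0 : 0 <= `|x| / rho by rewrite divr_ge0// ltW.
  have := tangent_powR p1 x0.
  have -> : (`|x| / rho) `^ p = `|x| `^ p * (rho `^ p)^-1.
    rewrite powRM ?invr_ge0 ?(ltW rho0)//; congr (_ * _).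
    by rewrite -(powR_inv1 (ltW rho0)) -powRrM mulN1r powRN.
  by apply.
rewrite big_split /= -!mulr_suml -/N rhop big_const_seq count_predT iter_addr_0.
rewrite -mulr_natr le_eqVlt; apply/orP; left; apply/eqP; field.
by rewrite !gt_eqF.
Qed.

Lemma powR_dist1 (q u : R) : 0 <= q <= 1 -> 0 < u -> `|u `^ q - 1| <= `|u - 1|.
Proof.
move=> /andP[q0 q1] u0; have [u1|u1] := leP 1 u.
  have h1 : 1 <= u `^ q by rewrite -(powRr0 u) ler_powR.
  by rewrite !ger0_norm ?subr_ge0// lerD2r ler1_powR.
have u01 : 0 < u <= 1 by rewrite u0 ltW.
have h1 : u `^ q <= 1 by rewrite -[leRHS](powRr0 u) ger_powR.
have h2 : u <= u `^ q by rewrite -[leLHS]powRr1 ?(ltW u0)// ger_powR.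
by rewrite !ler0_norm ?subr_le0// ?(ltW u1)// !opprB lerD2l lerN2.
Qed.

(** On the shell where [b.2] is close to [n r^p], the exponent of the spherical weight with kernel
    constant [r^(-p)] agrees with that of the linear tilt [s / r] up to a constant and an error of
    order [n dl]. *)
Lemma tilt_compare p n s r (dl : R) (b : R * R) :
  1 < p -> (0 < n)%N -> 0 < r -> 0 < b.2 ->
  `|b.1| <= n%:R * (b.2 / n%:R) `^ p^-1 ->
  `|b.2 / (n%:R * r `^ p) - 1| <= dl ->
  `|(s * b.1 / (b.2 / n%:R) `^ p^-1 - (r `^ p)^-1 * b.2 / p) -
    (s / r * b.1 - b.2 / p + n%:R * ((r `^ p - 1) / p))|
  <= n%:R * (dl * (`|s| + `|r `^ p - 1| / p)).
Proof.
move=> p1 n0 r0 b0 hb hdl; have p0 : 0 < p by lra.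
have N0 : 0 < n%:R :> R by rewrite ltr0n.
have rp0 : 0 < r `^ p by rewrite powR_gt0.
set rho := (b.2 / n%:R) `^ p^-1 in hb *.
have rho0 : 0 < rho by rewrite powR_gt0// divr_gt0.
set u := b.2 / (n%:R * r `^ p) in hdl.
have u0 : 0 < u by rewrite divr_gt0// mulr_gt0.
have rhoE : rho = r * u `^ p^-1.
  have -> : r = (r `^ p) `^ p^-1 by rewrite -powRrM mulfV ?gt_eqF// powRr1// ltW.
  rewrite -powRM ?(ltW rp0) ?(ltW u0)// /rho /u; congr (_ `^ _).
  by field; rewrite !gt_eqF.
have b2E : b.2 = n%:R * r `^ p * u by rewrite /u; field; rewrite !gt_eqF.
(* The difference is computed exactly; both terms vanish at [u = 1], the centre of the shell. *)
have -> : (s * b.1 / rho - (r `^ p)^-1 * b.2 / p) -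
    (s / r * b.1 - b.2 / p + n%:R * ((r `^ p - 1) / p)) =
    s * (b.1 / rho) * (1 - u `^ p^-1) + n%:R * (u - 1) * ((r `^ p - 1) / p).
  rewrite b2E rhoE; field.
  by rewrite !gt_eqF ?powR_gt0.
rewrite (le_trans (ler_normD _ _))//.
have -> : n%:R * (dl * (`|s| + `|r `^ p - 1| / p)) =
    n%:R * (dl * `|s|) + n%:R * (dl * (`|r `^ p - 1| / p)) by ring.
apply: lerD.
  rewrite !normrM (distrC 1).
  have h1 : `|u `^ p^-1 - 1| <= dl.
    by rewrite (le_trans (powR_dist1 _ u0))// invr_ge0 (ltW p0) invf_le1// ltW.
  have h2 : `|b.1| * `|rho^-1| <= n%:R.
    by rewrite normfV (gtr0_norm rho0) ler_pdivrMr.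
  rewrite (_ : n%:R * _ = `|s| * n%:R * dl); last by ring.
  by rewrite ler_pM// ?mulr_ge0// ler_wpM2l.
rewrite !normrM (ger0_norm (ltW N0)) normfV (gtr0_norm p0) -mulrA.
rewrite ler_wpM2l ?(ltW N0)// ler_wpM2r// divr_ge0// ltW//.
Qed.

Lemma stint_exp p n t c : 1 < p -> 0 < c ->
  stint p n (fun b => (expR (t * b.1) * expR (- (c * b.2 / p)))%:E) (0, 0) =
  (kint p t c ^+ n)%:E.
Proof.
move=> p1 c0.
have := @stint_eigen R p n (fun b => expR (t * b.1) * expR (- (c * b.2 / p)))
  (kint p t c) (0, 0) (ltW (kint_gt0 t p1 c0)).
rewrite !mulr0 mul0r oppr0 expR0 !mulr1; apply.
- apply: measurable_funM; last exact: measurable_expR_snd.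
  by apply: measurableT_comp; [exact: measurable_expR|exact: measurable_funM].
- by move=> b; rewrite mulr_ge0 ?expR_ge0.
- move=> b; rewrite mulrC EFinM -(kintE t p1 c0) -ge0_integralZl_EFin.
  + apply: eq_integral => x _; rewrite -EFinM -!expRD /yp /=; congr (expR _)%:E; ring.
  + exact: measurableT.
  + by move=> x _; rewrite lee_fin expR_ge0.
  + by apply/measurable_EFinP; exact: measurable_expR_kernel.
  + by apply: mulr_ge0; exact: expR_ge0.
Qed.

(** Unnormalized: [c_p p ^+ n] times this is the expectation of [exp (s n m)]. *)
Definition sphmgf p n s : R :=
  fine (stint p n (fun b => (sphexp p n s b * expR (- (1 * b.2 / p)))%:E) (0, 0)).

Lemma fst_sumst_le p (l : seq R) : 1 < p -> 0 < (foldl (addst p) (0, 0) l).2 ->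
  `|(foldl (addst p) (0, 0) l).1| <=
  (size l)%:R * ((foldl (addst p) (0, 0) l).2 / (size l)%:R) `^ p^-1.
Proof.
rewrite foldl_addst /= !add0r => p1 /(power_mean p1); apply: le_trans.
exact: ler_norm_sum.
Qed.

Lemma sphexp_le p n s (l : seq R) : 1 < p -> size l = n ->
  sphexp p n s (foldl (addst p) (0, 0) l) <= expR (n%:R * `|s|).
Proof.
move=> p1 ln; rewrite /sphexp; case: ifPn => [b0|_]; last exact: expR_ge0.
have n0 : 0 < n%:R :> R.
  by rewrite ltr0n -ln; case: (l) b0; rewrite //= ltxx.
have := fst_sumst_le p1 b0; rewrite ln; move: (foldl _ _ _) b0 => b b0 hb.
have rho0 : 0 < (b.2 / n%:R) `^ p^-1 by rewrite powR_gt0// divr_gt0.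
rewrite ler_expR (le_trans (ler_norm _))// !normrM normfV (gtr0_norm rho0).
rewrite ler_pdivrMr// (mulrC n%:R) -mulrA.
by rewrite ler_wpM2l.
Qed.

Lemma stint_sphexp_le p n s : 1 < p ->
  (stint p n (fun b => (sphexp p n s b * expR (- (1 * b.2 / p)))%:E) (0, 0)%R <=
   (expR (n%:R * `|s|) * kint p 0%R 1 ^+ n)%:E)%E.
Proof.
move=> p1; have c0 := expR_ge0 (n%:R * `|s|).
have ng : nneg_meas (EFin \o (fun b : R * R => expR (0 * b.1) * expR (- (1 * b.2 / p)))).
  apply: nneg_meas_EFin => [|b]; last by rewrite mulr_ge0 ?expR_ge0.
  apply: measurable_funM; last exact: measurable_expR_snd.
  by apply: measurableT_comp; [exact: measurable_expR|exact: measurable_funM].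
rewrite EFinM -(stint_exp n 0 p1 ltr01) -(stintZ p n _ c0 ng).
apply: stint_le => [b|l ln].
  by rewrite lee_fin mulr_ge0 ?sphexp_ge0 ?expR_ge0.
rewrite /= -EFinM lee_fin mul0r expR0 [1 * expR _]mul1r ler_wpM2r ?expR_ge0//.
exact: sphexp_le.
Qed.

Lemma sphmgfE p n s : 1 < p ->
  stint p n (fun b => (sphexp p n s b * expR (- (1 * b.2 / p)))%:E) (0, 0) =
  (sphmgf p n s)%:E.
Proof.
move=> p1; rewrite /sphmgf fineK// ge0_fin_numE; last first.
  apply: (nneg_meas_stint p n _).2; apply: nneg_meas_EFin => [|b].
    by apply: measurable_funM; [exact: measurable_sphexp|exact: measurable_expR_snd].
  by rewrite mulr_ge0 ?sphexp_ge0 ?expR_ge0.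
by apply: le_lt_trans (stint_sphexp_le n s p1) _; rewrite ltry.
Qed.

Lemma sphmgf_le p n s : 1 < p ->
  sphmgf p n s <= expR (n%:R * `|s|) * kint p 0 1 ^+ n.
Proof. by move=> p1; rewrite -lee_fin -sphmgfE// stint_sphexp_le. Qed.

(** The weight is homogeneous of degree 0, so only the Jacobian [c^(-n/p)] appears; this is the
    explicit [L] fed to [chernoff_window]. *)
Lemma sphmgf_scale p n s c : 1 < p -> 0 < c ->
  stint p n (fun b => (sphexp p n s b * expR (- (c * b.2 / p)))%:E) (0, 0) =
  ((c `^ (- p^-1)) ^+ n * sphmgf p n s)%:E.
Proof.
move=> p1 c0; have p0 : 0 < p by lra.
pose l := c `^ (p^-1).
have l0 : 0 < l by rewrite powR_gt0.
have lp : l `^ p = c by rewrite /l -powRrM mulVf ?gt_eqF// powRr1// ltW.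
rewrite powRN -/l.
have ng : nneg_meas (EFin \o (fun b => sphexp p n s b * expR (- (1 * b.2 / p)))).
  apply: nneg_meas_EFin => [|b].
    by apply: measurable_funM; [exact: measurable_sphexp|exact: measurable_expR_snd].
  by rewrite mulr_ge0 ?sphexp_ge0 ?expR_ge0.
have := stint_scale p n (0, 0) l0 ng; rewrite /= !mulr0.
have -> : stint p n (EFin \o (fun b => sphexp p n s b * expR (- (1 * b.2 / p)))) (0, 0)
  = (sphmgf p n s)%:E by exact: sphmgfE.
rewrite -EFinM => <-; apply: eq_stint => b /=.
by rewrite sphexp_scale// mul1r lp.
Qed.

Lemma sphmgf_ge0 p n s : 0 <= sphmgf p n s.
Proof.
apply: fine_ge0; apply: (nneg_meas_stint p n _).2; apply: nneg_meas_EFin => [|b].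
  by apply: measurable_funM; [exact: measurable_sphexp|exact: measurable_expR_snd].
by rewrite mulr_ge0 ?sphexp_ge0 ?expR_ge0.
Qed.

End SphericalAverages.

(** * Upper and lower exponential rates of the spherical moments *)

Section LaplaceRates.
Set Implicit Arguments. Unset Strict Implicit.
Context {R : realType}.
Implicit Types p t s r e : R.

Lemma ln1D_ge (h : R) : `|h| <= 2^-1 -> h - 2 * h ^+ 2 <= ln (1 + h).
Proof.
rewrite ler_norml => /andP[h1 h2]; have h0 : 0 < 1 + h by lra.
have : ln (1 + ((1 + h)^-1 - 1)) <= (1 + h)^-1 - 1.
  by apply: le_ln1Dx; have : 0 < (1 + h)^-1; [rewrite invr_gt0|lra].
rewrite (_ : 1 + (_ - 1) = (1 + h)^-1); last by ring.
rewrite lnV ?posrE// => hl.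
suff : h - 2 * h ^+ 2 <= 1 - (1 + h)^-1 by lra.
have -> : 1 - (1 + h)^-1 = h / (1 + h) by field; rewrite gt_eqF.
rewrite ler_pdivlMr//; have := sqr_ge0 h; nra.
Qed.

Lemma powRE (x y : R) : 0 < x -> x `^ y = expR (y * ln x).
Proof. by move=> x0; rewrite /powR gt_eqF. Qed.

Lemma measurable_sphexp_expR p n s c : measurable_fun setT
  (fun b : R * R => sphexp p n s b * expR (- (c * b.2 / p))).
Proof.
by apply: measurable_funM; [exact: measurable_sphexp|exact: measurable_expR_snd].
Qed.

Lemma measurable_expR_fst t : measurable_fun setT (fun b : R * R => expR (t * b.1)).
Proof.
by apply: measurableT_comp; [exact: measurable_expR|exact: measurable_funM].
Qed.

(** The spherical weight concentrates where the mean of [|x_i|^p] is near 1. Rescaling by [r] moves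
    this shell to [r^p], where the integrand is at most a constant times the linear tilt; the window
    is then dropped. *)
Lemma sphmgf_upper p s r e : 1 < p -> 0 < r -> 0 < e ->
  \forall n \near \oo, c_p p ^+ n * sphmgf p n s <= expR (n%:R * (Phi p s r + e)).
Proof.
move=> p1 r0 e0; have p0 : 0 < p by lra.
pose D : R := `|s| + `|r `^ p - 1| / p.
have D0 : 0 <= D by rewrite addr_ge0// divr_ge0// ltW.
pose dl := e / (2 * (D + 1)).
have D1 : 0 < 2 * (D + 1) by lra.
have dl0 : 0 < dl by rewrite divr_gt0.
have dlD : dl * D <= e / 2.
  have : dl * (2 * (D + 1)) = e by rewrite /dl divfK// gt_eqF.
  by lra.
have rp0 : 0 < r `^ p by rewrite powR_gt0.
(* The constant [2 / p] comes from [ln (1 + h) >= h - 2 h^2] multiplied by [- 1/p]. *)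
have := chernoff_window p0 (divr_ge0 (ler0n R 2) (ltW p0)) (divr_gt0 dl0 p0).
apply: filter_app; near=> n => ch.
have n0 : (0 < n)%N by near: n; exists 1%N.
have N0 : 0 < n%:R :> R by rewrite ltr0n.
have two : 2 <= expR (n%:R * (e / 2)).
  by near: n; apply: near_expRM_ge; rewrite divr_gt0.
pose A := sphmgf p n s.
have A0 : 0 <= A by exact: sphmgf_ge0.
pose phi (b : R * R) := sphexp p n s b * expR (- (1 * b.2 / p)) * window n p p^-1 (dl / p) b.
have phi0 b : 0 <= phi b by rewrite !mulr_ge0 ?sphexp_ge0 ?expR_ge0 ?window_ge0.
have mphi : measurable_fun setT phi.
  by apply: measurable_funM; [exact: measurable_sphexp_expR|exact: measurable_window].
pose I := stint p n (EFin \o phi) (0, 0).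
have step1 : (A%:E <= 2%:E * I)%E.
  have := ch (sphexp p n s) (fun c => (c `^ (- p^-1)) ^+ n * A) p^-1
    (measurable_sphexp _ _ _) (sphexp_ge0 _ _ _).
  rewrite /= powR1 expr1n mul1r; apply.
    move=> h hh; apply: sphmgf_scale => //; move: hh; rewrite ler_norml; lra.
  move=> h hh; rewrite mulrC ler_wpM2l// powRE; last by move: hh; rewrite ler_norml; lra.
  rewrite -expRM_natl ler_expR ler_pM2l//; have := ln1D_ge hh.
  have pi0 : 0 < p^-1 by rewrite invr_gt0.
  by move=> /(ler_wpM2l (ltW pi0)); lra.
pose M := expR (n%:R * ((r `^ p - 1) / p + e / 2)).
pose q (b : R * R) := expR (s / r * b.1) * expR (- (1 * b.2 / p)).
have mq : measurable_fun setT q.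
  by apply: measurable_funM; [exact: measurable_expR_fst|exact: measurable_expR_snd].
have q0 b : 0 <= q b by rewrite mulr_ge0 ?expR_ge0.
have l0 : 0 < r^-1 by rewrite invr_gt0.
have lp : r^-1 `^ p = (r `^ p)^-1 by rewrite -(powR_inv1 (ltW r0)) -powRrM mulN1r powRN.
(* After the substitution [sphexp] is unchanged, and the kernel constant becomes [r^(-p)]. *)
have step2 : (stint p n (fun b => (EFin \o phi) (r^-1 * b.1, r^-1 `^ p * b.2)%R) (0, 0)%R
    <= M%:E * (kint p (s / r)%R 1 ^+ n)%:E)%E.
  rewrite -(stint_exp n (s / r) p1 ltr01).
  rewrite -(stintZ p n (0, 0) (expR_ge0 _) (nneg_meas_EFin mq q0)).
  apply: stint_le => [b|l ln]; first by rewrite lee_fin.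
  have hb := fst_sumst_le p1 (l := l); rewrite ln in hb.
  move: (foldl _ _ _) hb => b hb.
  rewrite /= -EFinM lee_fin /phi sphexp_scale//.
  rewrite /window [(_, _).2]/=; case: ifPn => [hw|_]; last first.
    by rewrite mulr0 !mulr_ge0 ?expR_ge0.
  rewrite mulr1 /sphexp; case: ifPn => [b0|_]; last by rewrite mul0r !mulr_ge0 ?expR_ge0.
  have hw' : `|b.2 / (n%:R * r `^ p) - 1| <= dl.
    have -> : b.2 / (n%:R * r `^ p) - 1 = (r^-1 `^ p * b.2 / (n%:R * p) - p^-1) * p.
      by rewrite lp; field; rewrite !gt_eqF.
    by rewrite normrM (gtr0_norm p0) -ler_pdivlMr// ltW.
  have := tilt_compare s p1 n0 r0 b0 (hb b0) hw'.
  rewrite -/D ler_norml => /andP[_ hc].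
  rewrite /q /M -!expRD ler_expR ?[(_, _).2]/= lp.
  have := ler_wpM2l (ltW N0) dlD.
  by lra.
have step3 : (I <= ((r^-1) ^+ n * (M * kint p (s / r)%R 1 ^+ n))%:E)%E.
  have rn0 : 0 <= r^-1 ^+ n by rewrite exprn_ge0// ltW.
  move: step2; rewrite (stint_scale p n (0, 0) l0 (nneg_meas_EFin mphi phi0)) /= !mulr0 -/I.
  move=> /(@lee_wpmul2l _ (r^-1 ^+ n)%:E); rewrite lee_fin => /(_ rn0).
  by rewrite muleA -EFinM invrK -exprMn mulVf ?gt_eqF// expr1n mul1e -!EFinM.
have step4 : A <= 2 * ((r^-1) ^+ n * (M * kint p (s / r) 1 ^+ n)).
  rewrite -lee_fin EFinM (le_trans step1)// lee_wpmul2l// lee_fin//.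
have cp0 := c_p_gt0 p1.
rewrite -/A (le_trans (ler_wpM2l (exprn_ge0 n (ltW cp0)) step4))//.
rewrite (_ : c_p p ^+ n * _ = 2 * (r^-1 ^+ n * M * (c_p p * kint p (s / r) 1) ^+ n)); last first.
  rewrite [(c_p p * _) ^+ n]exprMn.
  by move: (c_p p ^+ n) (r^-1 ^+ n) (kint _ _ _ ^+ n) => x y z; ring.
rewrite -expR_lmgf// -expRM_natl.
have -> : r^-1 ^+ n = expR (n%:R * - ln r) by rewrite expRM_natl expRN lnK.
rewrite -!expRD.
rewrite (_ : Phi p s r + e = (- ln r + ((r `^ p - 1) / p + e / 2) + lmgf p (s / r)) + e / 2); last first.
  by rewrite /Phi; field; rewrite gt_eqF.
by rewrite [in leRHS]mulrDr [leRHS]expRD mulrC -!mulrDr ler_wpM2l ?expR_ge0.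
Unshelve. all: by end_near. Qed.

(** The comparison is reversed: [tilted] makes the linear tilt [s / r] itself concentrate on the
    shell [r^p], so half of its mass is bounded by the spherical integral. *)
Lemma sphmgf_lower p s r e : 1 < p -> tilted p (s / r) r -> 0 < e ->
  \forall n \near \oo, expR (n%:R * (Phi p s r - e)) <= c_p p ^+ n * sphmgf p n s.
Proof.
move=> p1 [r0 [C C0 hC]] e0; have p0 : 0 < p by lra.
pose D : R := `|s| + `|r `^ p - 1| / p.
have D0 : 0 <= D by rewrite addr_ge0// divr_ge0// ltW.
(* The bound [1/2] keeps the window away from [b.2 = 0], where [sphexp] takes the value 0. *)
pose dl := Num.min 2^-1 (e / (2 * (D + 1))).
have D1 : 0 < 2 * (D + 1) by lra.
have dl0 : 0 < dl by rewrite lt_min invr_gt0 ltr0n divr_gt0.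
have dl1 : dl <= 2^-1 by rewrite ge_min lexx.
have dlD : dl * D <= e / 2.
  have : dl * (2 * (D + 1)) <= e by rewrite -ler_pdivlMr// ge_min lexx orbT.
  by lra.
have rp0 : 0 < r `^ p by rewrite powR_gt0.
have de0 : 0 < dl * (r `^ p / p) by rewrite mulr_gt0// divr_gt0.
have := chernoff_window p0 C0 de0.
apply: filter_app; near=> n => ch.
have n0 : (0 < n)%N by near: n; exists 1%N.
have N0 : 0 < n%:R :> R by rewrite ltr0n.
have two : 2 <= expR (n%:R * (e / 2)).
  by near: n; apply: near_expRM_ge; rewrite divr_gt0.
pose A := sphmgf p n s.
have A0 : 0 <= A by exact: sphmgf_ge0.
set t := s / r in hC *.
have k0 := kint_gt0 t p1 ltr01.
pose M := expR (n%:R * (e / 2 - (r `^ p - 1) / p)).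
pose c := (r `^ p)^-1.
have c0 : 0 < c by rewrite invr_gt0.
pose q (b : R * R) := sphexp p n s b * expR (- (c * b.2 / p)).
have mq : measurable_fun setT q by exact: measurable_sphexp_expR.
have q0 b : 0 <= q b by rewrite mulr_ge0 ?expR_ge0 ?sphexp_ge0.
have step1 : ((kint p t 1 ^+ n)%:E <= 2%:E * (M%:E * (r ^+ n * A)%:E))%E.
  apply: le_trans (ch (fun b => expR (t * b.1)) (fun c => kint p t c ^+ n) (r `^ p / p)
    (measurable_expR_fst _) (fun b => expR_ge0 _) _ _) _.
  - move=> h hh; apply: stint_exp => //; move: hh; rewrite ler_norml; lra.
  - move=> h hh; rewrite expRM_natl -exprMn lerXn2r ?nnegrE//.
    + by rewrite ltW// kint_gt0//; move: hh; rewrite ler_norml; lra.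
    + by rewrite mulr_ge0 ?expR_ge0// ltW.
    + exact: hC.
  apply: lee_wpmul2l; first by rewrite lee_fin.
  have <- : stint p n (EFin \o q) (0, 0) = (r ^+ n * A)%:E.
    rewrite /q (sphmgf_scale n s p1 c0); congr (_ ^+ n * _)%:E.
    have cr : c = r^-1 `^ p by rewrite /c -(powR_inv1 (ltW r0)) -powRrM mulN1r powRN.
    by rewrite cr powRN -powRrM mulfV ?gt_eqF// powRr1 ?invr_ge0 ?(ltW r0)// invrK.
  rewrite -(stintZ p n (0, 0) (expR_ge0 _) (nneg_meas_EFin mq q0)).
  apply: stint_le => [b|l ln].
    by rewrite lee_fin !mulr_ge0 ?expR_ge0 ?window_ge0.
  have hb := fst_sumst_le p1 (l := l); rewrite ln in hb.
  move: (foldl _ _ _) hb => b hb.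
  rewrite /= -EFinM lee_fin /window; case: ifPn => [hw|_]; last first.
    by rewrite mulr0 !mulr_ge0 ?expR_ge0 ?sphexp_ge0.
  have hw' : `|b.2 / (n%:R * r `^ p) - 1| <= dl.
    have -> : b.2 / (n%:R * r `^ p) - 1 = (b.2 / (n%:R * p) - r `^ p / p) / (r `^ p / p).
      by field; rewrite !gt_eqF.
    rewrite normrM normfV [X in _ / X]gtr0_norm ?divr_gt0//.
    by rewrite ler_pdivrMr ?divr_gt0// ltW.
  have b0 : 0 < b.2.
    have : 0 < b.2 / (n%:R * r `^ p) by move: hw'; rewrite ler_norml; lra.
    by rewrite pmulr_lgt0// invr_gt0 mulr_gt0.
  have := tilt_compare s p1 n0 r0 b0 (hb b0) hw'.
  rewrite -/D -/c ler_norml => /andP[hc _].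
  rewrite mulr1 /q /sphexp b0 /M -!expRD ler_expR -/t.
  have := ler_wpM2l (ltW N0) dlD.
  by rewrite -/t in hc; rewrite mulrBr; lra.
have step2 : kint p t 1 ^+ n <= 2 * (M * (r ^+ n * A)) by rewrite -lee_fin !EFinM.
have cp0 := c_p_gt0 p1.
have rnE : r ^+ n = expR (n%:R * ln r) by rewrite expRM_natl lnK.
have := ler_wpM2l (exprn_ge0 n (ltW cp0)) step2.
rewrite -exprMn -expR_lmgf// -expRM_natl rnE => step3.
have E1 : c_p p ^+ n * (2 * (M * (expR (n%:R * ln r) * A))) =
    2 * (expR (n%:R * (e / 2 - (r `^ p - 1) / p + ln r)) * (c_p p ^+ n * A)).
  by rewrite mulrDr expRD -/M; ring.
rewrite E1 in step3.
rewrite (_ : Phi p s r - e = lmgf p t - (e / 2 - (r `^ p - 1) / p + ln r) - e / 2); last first.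
  by rewrite /Phi -/t; field; rewrite gt_eqF.
rewrite mulrBr mulrBr 2!expRB -/A ler_pdivrMr ?expR_gt0// ler_pdivrMr ?expR_gt0//.
rewrite (le_trans step3)//.
set EY := expR (n%:R * (e / 2 - _ + _)); set B := _ * A.
rewrite (_ : 2 * (EY * B) = EY * B * 2); last by ring.
rewrite (_ : B * _ * _ = EY * B * expR (n%:R * (e / 2))); last by ring.
by rewrite ler_wpM2l// mulr_ge0 ?expR_ge0// mulr_ge0 ?exprn_ge0// ltW.
Unshelve. all: by end_near. Qed.

End LaplaceRates.

(** * The Hamiltonian as a square minus its diagonal *)

Section PartitionFunction.
Set Implicit Arguments. Unset Strict Implicit.
Context {R : realType}.
Implicit Types p t s r e beta : R.

Lemma sum_lt_pairs n (f : 'I_n -> R) :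
  2 * \sum_(i < n) \sum_(j < n | (i < j)%N) f i * f j =
  (\sum_(i < n) f i) ^+ 2 - \sum_(i < n) f i ^+ 2.
Proof.
have sw : \sum_(i < n) \sum_(j < n | (j < i)%N) f i * f j =
    \sum_(i < n) \sum_(j < n | (i < j)%N) f i * f j.
  rewrite (exchange_big_dep predT)//=; apply: eq_bigr => i _; apply: eq_bigr => j _.
  by rewrite mulrC.
have -> : (\sum_(i < n) f i) ^+ 2 = \sum_(i < n) (\sum_(j < n | (i < j)%N) f i * f j
    + \sum_(j < n | (j < i)%N) f i * f j + f i ^+ 2).
  rewrite expr2 mulr_suml; apply: eq_bigr => i _; rewrite mulr_sumr.
  rewrite (bigID (fun j : 'I_n => (i < j)%N)) /= -addrA; congr (_ + _).
  rewrite (bigD1 i) ?ltnn//= addrC -expr2; congr (_ + _).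
  by apply: eq_bigl => j; rewrite -leqNgt ltn_neqAle andbC.
by rewrite !big_split /= sw; ring.
Qed.

Lemma HamE (l : seq R) :
  Ham l = ((\sum_(x <- l) x) ^+ 2 - \sum_(x <- l) x ^+ 2) / (2 * (size l)%:R).
Proof.
have h1 : \sum_(x <- l) x = \sum_(i < size l) l`_i by rewrite (big_nth 0) big_mkord.
have h2 : \sum_(x <- l) x ^+ 2 = \sum_(i < size l) l`_i ^+ 2.
  by rewrite (big_nth 0) big_mkord.
rewrite /Ham h1 h2 -(sum_lt_pairs (fun i : 'I_(size l) => l`_i)).
by rewrite invfM; move: (size l)%:R^-1 => v; field.
Qed.

Lemma pnormE p (l : seq R) :
  pnorm p l = ((\sum_(x <- l) `|x| `^ p) / (size l)%:R) `^ p^-1.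
Proof. by rewrite /pnorm (big_nth 0) big_mkord mulrC. Qed.

Lemma prod_rho p (l : seq R) : \prod_(x <- l) rho p x =
  c_p p ^+ size l * expR (- (1 * (\sum_(x <- l) `|x| `^ p) / p)).
Proof.
elim: l => [|x l IH]; first by rewrite !big_nil mulr0 mul0r oppr0 expR0 expr0 mulr1.
rewrite !big_cons IH /rho [size (_ :: _)]/= exprS !mul1r.
by rewrite mulrDl opprD expRD mulNr; ring.
Qed.

(** Each [|x|^p] is at most [n], so [x^2 = |x|^p |x|^(2-p) <= |x|^p n^((2-p)/p)]. Divided by [2 n],
    the resulting [n^(2/p)] is [o(n)] because [p > 1]. *)
Lemma sum_sqr_le p (l : seq R) : 1 < p -> p < 2 ->
  \sum_(x <- l) `|x| `^ p = (size l)%:R ->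
  \sum_(x <- l) x ^+ 2 <= (size l)%:R `^ (2 / p).
Proof.
move=> p1 p2 hl; have p0 : 0 < p by lra.
set n := (size l)%:R in hl *.
have n0 : 0 <= n by exact: ler0n.
have h x : x \in l -> x ^+ 2 <= `|x| `^ p * n `^ ((2 - p) / p).
  move=> xl; have xn : `|x| `^ p <= n.
    rewrite -hl (big_rem x xl) /= lerDl; apply: sumr_ge0 => y _; exact: powR_ge0.
  have -> : x ^+ 2 = `|x| `^ p * (`|x| `^ p) `^ ((2 - p) / p).
    rewrite -powRrM mulrCA divff ?gt_eqF// mulr1 -powRD ?subrK; last first.
      by apply/implyP; lra.
    by rewrite addrC subrK powR_mulrn// real_normK// num_real.
  rewrite ler_wpM2l ?powR_ge0// ge0_ler_powR ?nnegrE ?powR_ge0//.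
  by rewrite divr_ge0; lra.
apply: (@le_trans _ _ (\sum_(x <- l) `|x| `^ p * n `^ ((2 - p) / p))).
  by rewrite big_seq [leRHS]big_seq; apply: ler_sum => x; exact: h.
rewrite -mulr_suml hl.
have [n00|nn0] := eqVneq n 0; first by rewrite n00 mul0r powR_ge0.
rewrite -{1}(powRr1 n0) -powRD ?nn0 ?implybT//.
by rewrite (_ : 1 + _ = 2 / p)//; field; rewrite gt_eqF.
Qed.

Definition zdens p beta (l : seq R) : R :=
  if pnorm p l == 0 then 0 else expR (beta * Ham [seq x / pnorm p l | x <- l]).

Lemma zdens_ge0 p beta l : 0 <= zdens p beta l.
Proof. by rewrite /zdens; case: ifP => // _; exact: expR_ge0. Qed.

Lemma pnorm_gt0 p (l : seq R) : 0 < p -> 0 < \sum_(x <- l) `|x| `^ p -> 0 < pnorm p l.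
Proof.
move=> p0 N0; rewrite pnormE powR_gt0// divr_gt0// ltr0n lt0n.
by apply: contraTneq N0 => /size0nil ->; rewrite big_nil ltxx.
Qed.

Lemma zdens_bounds p beta (l : seq R) : 1 < p -> p < 2 -> 0 <= beta ->
  0 < \sum_(x <- l) `|x| `^ p ->
  let n := (size l)%:R in
  let S := (\sum_(x <- l) x) / pnorm p l in
  [/\ `|S| <= n, zdens p beta l <= expR (beta * (S ^+ 2 / (2 * n))) &
   expR (beta * (S ^+ 2 / (2 * n)) - beta * (n `^ (2 / p) / (2 * n))) <= zdens p beta l].
Proof.
move=> p1 p2 b0 N0 n S; have p0 : 0 < p by lra.
have rho0 := pnorm_gt0 p0 N0.
have n0 : 0 < n.
  rewrite /n ltr0n lt0n; apply: contraTneq N0 => /size0nil ->; by rewrite big_nil ltxx.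
set rho := pnorm p l in S rho0 *.
have rhop : rho `^ p = (\sum_(x <- l) `|x| `^ p) / n.
  by rewrite /rho pnormE -powRrM mulVf ?gt_eqF// powRr1// ltW// divr_gt0.
have hS : `|S| <= n.
  rewrite /S normrM normfV (gtr0_norm rho0) ler_pdivrMr//.
  rewrite (le_trans (ler_norm_sum _ _ _))//.
  by have := power_mean p1 N0; rewrite -pnormE.
rewrite /zdens -/rho gt_eqF// HamE size_map -/n !big_map -mulr_suml -/S.
set Q := \sum_(x <- l) (x / rho) ^+ 2.
have Q0 : 0 <= Q by apply: sumr_ge0 => x _; exact: sqr_ge0.
have Qn : Q <= n `^ (2 / p).
  have := @sum_sqr_le p [seq x / rho | x <- l] p1 p2.
  rewrite size_map !big_map; apply.
  under eq_bigr => x _.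
    have -> : `|x / rho| `^ p = `|x| `^ p * (rho `^ p)^-1.
      rewrite normrM normfV (gtr0_norm rho0) powRM ?invr_ge0 ?(ltW rho0)//.
      congr (_ * _).
      by rewrite -(powR_inv1 (ltW rho0)) -powRrM mulN1r powRN.
    over.
  rewrite -mulr_suml rhop invfM invrK mulrA divff ?mul1r// gt_eqF//.
have n2 : 0 < (2 * n)^-1 by rewrite invr_gt0 mulr_gt0.
split => //; rewrite ler_expR -?mulrBr ler_wpM2l//.
  by rewrite ler_wpM2r ?(ltW n2)// lerBlDr lerDl.
by rewrite -mulrBl ler_wpM2r ?(ltW n2)// lerB.
Qed.

Lemma zdens_sum0 p beta (l : seq R) : 0 < p ->
  \sum_(x <- l) `|x| `^ p <= 0 -> zdens p beta l = 0.
Proof.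
move=> p0 hN; have N0 : \sum_(x <- l) `|x| `^ p = 0.
  by apply/eqP; rewrite eq_le hN sumr_ge0// => x _; exact: powR_ge0.
by rewrite /zdens pnormE N0 mul0r powR0 ?eqxx// invr_eq0 gt_eqF.
Qed.

End PartitionFunction.

(** * Linearization of the square in the partition function *)

Section PartitionLimit.
Set Implicit Arguments. Unset Strict Implicit.
Context {R : realType}.
Implicit Types p t s r e beta : R.

Lemma ex_grid (B d : R) : 0 < d -> exists G : seq R,
  forall v, `|v| <= B -> exists2 s, s \in G & `|v - s| <= d.
Proof.
move=> d0; exists [seq k%:R * d - B | k <- iota 0 (Num.truncn (2 * B / d)).+1] => v.
rewrite ler_norml => /andP[v1 v2].
have vB : 0 <= (v + B) / d by rewrite divr_ge0// ?(ltW d0)//; lra.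
have /andP[k1 k2] := truncn_itv vB.
set k := Num.truncn _ in k1 k2.
exists (k%:R * d - B).
  apply/mapP; exists k => //; rewrite mem_iota /= add0n ltnS.
  by apply: le_truncn; rewrite ler_pM2r ?invr_gt0//; lra.
move: k1 k2; rewrite ler_pdivlMr// ltr_pdivrMr// -natr1 mulrDl mul1r => k1 k2.
by rewrite ler_norml; apply/andP; split; lra.
Qed.

Lemma stint_sum p n (G : seq R) (k A : R -> R) (g : R -> R * R -> R) :
  (forall s, 0 <= k s) -> (forall s, measurable_fun setT (g s)) ->
  (forall s b, 0 <= g s b) ->
  (forall s, stint p n (EFin \o g s) (0, 0) = (A s)%:E) ->
  stint p n (fun b => (\sum_(s <- G) k s * g s b)%:E) (0, 0) =
  (\sum_(s <- G) k s * A s)%:E.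
Proof.
move=> k0 mg g0 hA.
have mS H : measurable_fun setT (fun b => \sum_(s <- H) k s * g s b).
  by apply: measurable_sum => s; exact: measurable_funM.
have S0 H b : 0 <= \sum_(s <- H) k s * g s b.
  by apply: sumr_ge0 => s _; exact: mulr_ge0.
elim: G => [|s G IH].
  (* The empty sum is written as 0 times an arbitrary integral, so that [stintZ] evaluates it. *)
  have -> : (\sum_(s <- [::]) k s * A s)%:E = (0%:E * (A 0%R)%:E)%E.
    by rewrite big_nil mul0e.
  rewrite -hA -(stintZ p n (0, 0) (lexx 0) (nneg_meas_EFin (mg 0) (g0 0))).
  by apply: eq_stint => b; rewrite big_nil mul0e.
rewrite big_cons EFinD EFinM -hA -IH -(stintZ p n (0, 0) (k0 s) (nneg_meas_EFin (mg s) (g0 s))).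
have nz : nneg_meas (fun b => (k s)%:E * (EFin \o g s) b)%E.
  apply: (@nneg_meas_EFin _ (fun b => k s * g s b)); first exact: measurable_funM.
  by move=> b; rewrite mulr_ge0.
rewrite -(stintD p n (0, 0) nz (nneg_meas_EFin (mS G) (S0 G))).
by apply: eq_stint => b /=; rewrite big_cons.
Qed.

Definition sphdens p n s (b : R * R) : R := sphexp p n s b * expR (- (1 * b.2 / p)).

Lemma sphdens_ge0 p n s b : 0 <= sphdens p n s b.
Proof. by rewrite mulr_ge0 ?sphexp_ge0 ?expR_ge0. Qed.

Lemma measurable_sphdens p n s : measurable_fun setT (sphdens p n s).
Proof. exact: measurable_sphexp_expR. Qed.

(** The integral inside [Zpart] before [fine]; bounds on it transfer to [Zpart] once it is known to
    be finite. *)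
Definition zint n p beta : \bar R :=
  iter_int n (fun l => (zdens p beta l * \prod_(x <- l) rho p x)%:E).

Lemma zint_ge0 n p beta : 1 < p -> (0 <= zint n p beta)%E.
Proof.
move=> p1; apply: iter_int_ge0 => l; rewrite lee_fin mulr_ge0 ?zdens_ge0// prod_rho.
by rewrite mulr_ge0 ?expR_ge0// exprn_ge0// ltW// c_p_gt0.
Qed.

(** With [v = sqrt beta m], [v^2 / 2 = s v - s^2 / 2 + (v - s)^2 / 2], and some grid point [s] makes
    the last term at most [eta]. Summing over the whole grid avoids selecting [s] measurably from
    the configuration. *)
Lemma zint_le n p beta (eta : R) (G : seq R) : 1 < p -> p < 2 -> 0 <= beta ->
  (forall v, `|v| <= Num.sqrt beta -> exists2 s, s \in G & (v - s) ^+ 2 <= 2 * eta) ->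
  (zint n p beta <= (\sum_(s <- G) expR (n%:R * (eta - s ^+ 2 / 2)) *
     (c_p p ^+ n * sphmgf p n (Num.sqrt beta * s)))%:E)%E.
Proof.
move=> p1 p2 b0 hG; have p0 : 0 < p by lra.
have cp0 : 0 < c_p p ^+ n by rewrite exprn_gt0// c_p_gt0.
pose k s := expR (n%:R * (eta - s ^+ 2 / 2)) * c_p p ^+ n.
have k0 s : 0 <= k s by rewrite mulr_ge0 ?expR_ge0// ltW.
under eq_bigr do rewrite mulrA -/(k _).
rewrite -(@stint_sum p n G k (fun s => sphmgf p n (Num.sqrt beta * s))
  (fun s => sphdens p n (Num.sqrt beta * s)) k0
  (fun s => measurable_sphdens p n (Num.sqrt beta * s))
  (fun s => sphdens_ge0 p n (Num.sqrt beta * s))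
  (fun s => sphmgfE n (Num.sqrt beta * s) p1)).
rewrite -iter_int_stint; apply: iter_int_le => [l|l ln].
  rewrite lee_fin mulr_ge0 ?zdens_ge0// prod_rho.
  by rewrite mulr_ge0 ?expR_ge0// exprn_ge0// ltW// c_p_gt0.
rewrite lee_fin prod_rho ln foldl_addst /= !add0r.
set N := \sum_(x <- l) `|x| `^ p; set S := \sum_(x <- l) x.
have [N0|N0] := leP N 0.
  by rewrite zdens_sum0// mul0r sumr_ge0// => s _; rewrite mulr_ge0 ?sphdens_ge0.
have [hS hz _] := zdens_bounds p1 p2 b0 N0.
rewrite ln -/S in hS hz.
have rho0 := pnorm_gt0 p0 N0.
have n0 : 0 < n%:R :> R.
  rewrite -ln ltr0n lt0n; apply: contraTneq N0 => /size0nil l0.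
  by rewrite /N l0 big_nil ltxx.
pose m := S / pnorm p l / n%:R.
have [s sG hs] : exists2 s, s \in G & (Num.sqrt beta * m - s) ^+ 2 <= 2 * eta.
  apply: hG; rewrite normrM (ger0_norm (sqrtr_ge0 _)) ler_piMr ?sqrtr_ge0//.
  by rewrite /m normrM normfV (gtr0_norm n0) ler_pdivrMr// mul1r.
rewrite (big_rem s sG) /=; apply: (@le_trans _ _ (k s * sphdens p n (Num.sqrt beta * s) (S, N))).
  rewrite /sphdens /sphexp /= N0 -ln -pnormE ln.
  rewrite /k (mulrC (expR _) (c_p p ^+ n)) [leLHS]mulrCA -[leRHS]mulrA.
  apply: ler_wpM2l; first exact: ltW.
  rewrite mulrA ler_wpM2r ?expR_ge0// (le_trans hz)// -expRD ler_expR.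
  have -> : S / pnorm p l = n%:R * m by rewrite /m mulrCA divff ?mulr1// gt_eqF.
  have -> : Num.sqrt beta * s * S / pnorm p l = n%:R * (Num.sqrt beta * s * m).
    by rewrite -[LHS]mulrA (_ : S / _ = n%:R * m); [ring|rewrite /m mulrCA divff ?mulr1// gt_eqF].
  have -> : beta * ((n%:R * m) ^+ 2 / (2 * n%:R)) = n%:R * (beta * m ^+ 2 / 2).
    by field; rewrite gt_eqF.
  rewrite -mulrDr ler_pM2l//.
  have hb : beta = Num.sqrt beta ^+ 2 by rewrite sqr_sqrtr.
  by rewrite [X in X * m ^+ 2]hb; move: hs; nra.
by rewrite lerDl sumr_ge0// => s' _; rewrite mulr_ge0 ?sphdens_ge0.
Qed.

Lemma zint_fin_num n p beta : 1 < p -> p < 2 -> 0 <= beta -> zint n p beta \is a fin_num.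
Proof.
move=> p1 p2 b0; rewrite ge0_fin_numE ?zint_ge0//.
have [G hG] := ex_grid (Num.sqrt beta) (@ltr01 R).
have hG' v : `|v| <= Num.sqrt beta -> exists2 s, s \in G & (v - s) ^+ 2 <= 2 * 1.
  move=> /hG[s sG hs]; exists s => //; rewrite -[leLHS]real_normK ?num_real//.
  have := normr_ge0 (v - s); nra.
by rewrite (le_lt_trans (zint_le n p1 p2 b0 hG'))// ltry.
Qed.

Lemma Zpart_le n p beta (eta : R) (G : seq R) : 1 < p -> p < 2 -> 0 <= beta ->
  (forall v, `|v| <= Num.sqrt beta -> exists2 s, s \in G & (v - s) ^+ 2 <= 2 * eta) ->
  Zpart n p beta <= \sum_(s <- G) expR (n%:R * (eta - s ^+ 2 / 2)) *
     (c_p p ^+ n * sphmgf p n (Num.sqrt beta * s)).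
Proof.
move=> p1 p2 b0 hG; rewrite -lee_fin -[Zpart _ _ _]/(fine (zint n p beta)).
by rewrite fineK ?zint_fin_num//; exact: zint_le.
Qed.

(** For every [s], [v^2 / 2 >= s v - s^2 / 2] at [v = sqrt beta m]; the extra term in the exponent
    is the bound on the diagonal. *)
Lemma Zpart_ge n p beta s : 1 < p -> p < 2 -> 0 <= beta ->
  expR (- (n%:R * (s ^+ 2 / 2)) - beta * (n%:R `^ (2 / p) / (2 * n%:R))) *
    (c_p p ^+ n * sphmgf p n (Num.sqrt beta * s)) <= Zpart n p beta.
Proof.
move=> p1 p2 b0; have p0 : 0 < p by lra.
have cp0 : 0 < c_p p ^+ n by rewrite exprn_gt0// c_p_gt0.
rewrite -lee_fin -[Zpart _ _ _]/(fine (zint n p beta)) fineK ?zint_fin_num//.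
set k := expR _; rewrite mulrA.
have k0 : 0 <= k * c_p p ^+ n by rewrite mulr_ge0 ?expR_ge0// ltW.
rewrite EFinM -sphmgfE// -(stintZ p n (0, 0) k0 (nneg_meas_EFin
  (measurable_sphdens p n (Num.sqrt beta * s)) (sphdens_ge0 p n _))).
rewrite -iter_int_stint; apply: iter_int_le => [l|l ln].
  by rewrite -EFinM lee_fin mulr_ge0// sphdens_ge0.
rewrite -EFinM lee_fin prod_rho ln foldl_addst /= !add0r.
set N := \sum_(x <- l) `|x| `^ p; set S := \sum_(x <- l) x.
have [N0|N0] := leP N 0.
  rewrite /sphdens /sphexp /= ltNge N0 /= mul0r mulr0 !mulr_ge0 ?zdens_ge0 ?expR_ge0//.
  exact: ltW.
have [hS _ hz] := zdens_bounds p1 p2 b0 N0.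
rewrite ln -/S in hS hz.
have rho0 := pnorm_gt0 p0 N0.
have n0 : 0 < n%:R :> R.
  rewrite -ln ltr0n lt0n; apply: contraTneq N0 => /size0nil l0.
  by rewrite /N l0 big_nil ltxx.
pose m := S / pnorm p l / n%:R.
rewrite /sphdens /sphexp /= N0 -ln -pnormE ln.
rewrite (mulrC k) -[leLHS]mulrA [leRHS]mulrCA.
apply: ler_wpM2l; first exact: ltW.
rewrite mulrA ler_wpM2r ?expR_ge0// (le_trans _ hz)// /k -expRD ler_expR.
have -> : S / pnorm p l = n%:R * m by rewrite /m mulrCA divff ?mulr1// gt_eqF.
have -> : Num.sqrt beta * s * S / pnorm p l = n%:R * (Num.sqrt beta * s * m).
  by rewrite -[LHS]mulrA (_ : S / _ = n%:R * m); [ring|rewrite /m mulrCA divff ?mulr1// gt_eqF].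
have -> : beta * ((n%:R * m) ^+ 2 / (2 * n%:R)) = n%:R * (beta * m ^+ 2 / 2).
  by field; rewrite gt_eqF.
rewrite addrAC lerD2r addrC -mulrBr ler_pM2l//.
have hb : beta = Num.sqrt beta ^+ 2 by rewrite sqr_sqrtr.
rewrite [X in X * m ^+ 2]hb; have := sqr_ge0 (Num.sqrt beta * m - s); nra.
Qed.

End PartitionLimit.

(** * The variational formula for [Ep] *)

Section Limits.
Set Implicit Arguments. Unset Strict Implicit.
Context {R : realType}.
Implicit Types p t s r e l beta : R.

(** Says that [l] is the exponential growth rate [Lam s], as a two-sided bound that passes directly
    through sums and products. *)
Definition rate p s l := forall e, 0 < e -> \forall n \near \oo,
  expR (n%:R * (l - e)) <= c_p p ^+ n * sphmgf p n s <= expR (n%:R * (l + e)).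

Lemma le_of_near_expR (a b : R) :
  (forall e, 0 < e -> \forall n \near \oo, expR (n%:R * (a - e)) <= expR (n%:R * (b + e))) ->
  a <= b.
Proof.
move=> H; apply/ler_addgt0Pr => e e0; have e2 : 0 < e / 2 by lra.
have n1 : \forall n \near \oo, (0 < n)%N by exists 1%N.
have [n [n0]] := filter_ex (filterI n1 (H _ e2)).
by rewrite ler_expR ler_pM2l ?ltr0n//; lra.
Qed.

(** At an [r] with [tilted p (s / r) r], the upper and lower rates are the same number
    [Phi p s r]. *)
Lemma ex_rate p s : 1 < p -> exists l, rate p s l.
Proof.
move=> p1; have [r rt] := ex_tilted_div s p1; have r0 := rt.1.
exists (Phi p s r) => e e0.
have U := sphmgf_upper s p1 r0 e0; have L := sphmgf_lower p1 rt e0.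
by apply: filterS2 L U => n h1 h2; apply/andP.
Qed.

Lemma rate_le_Phi p s l r : 1 < p -> rate p s l -> 0 < r -> l <= Phi p s r.
Proof.
move=> p1 hl r0; apply: le_of_near_expR => e e0.
apply: filterS2 (hl e e0) (sphmgf_upper s p1 r0 e0) => n /andP[h1 _].
exact: le_trans.
Qed.

Lemma rate_ge_Phi p s l r : 1 < p -> rate p s l -> tilted p (s / r) r -> Phi p s r <= l.
Proof.
move=> p1 hl rt; apply: le_of_near_expR => e e0.
apply: filterS2 (hl e e0) (sphmgf_lower p1 rt e0) => n /andP[_ h2] h1.
exact: le_trans h1 h2.
Qed.

(** Crude bound from [|m| <= 1]. Its linear growth in [s] is beaten by [s^2 / 2], which makes the
    supremum defining [E] finite. *)
Lemma rate_le p s l : 1 < p -> rate p s l -> l <= `|s| + lmgf p 0.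
Proof.
move=> p1 hl; apply: le_of_near_expR => e e0.
apply: filterS (hl e e0) => n /andP[h1 _]; apply: (le_trans h1).
have cp0 : 0 <= c_p p ^+ n by rewrite exprn_ge0// ltW// c_p_gt0.
apply: (le_trans (ler_wpM2l cp0 (sphmgf_le n s p1))).
rewrite mulrCA -exprMn -expR_lmgf// -expRM_natl -expRD ler_expR -mulrDr.
by rewrite ler_wpM2l// lerDl ltW.
Qed.

Lemma near_all_seq (G : seq R) (P : R -> nat -> Prop) :
  (forall s, \forall n \near \oo, P s n) ->
  \forall n \near \oo, forall s, s \in G -> P s n.
Proof.
move=> H; elim: G => [|s G IH]; first by apply: nearW => n s.
apply: filterS2 (H s) IH => n h1 h2 s'; rewrite inE => /predU1P[->//|]; exact: h2.
Qed.

Lemma near_powR_ge (g M : R) : 0 < g -> \forall n \near \oo, M <= n%:R `^ g.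
Proof.
move=> g0; near=> n.
have : `|M| `^ g^-1 <= n%:R by near: n; exact: nbhs_infty_ger.
move=> /(ge0_ler_powR (ltW g0)); rewrite !nnegrE powR_ge0 ler0n => /(_ isT isT).
rewrite -powRrM mulVf ?gt_eqF// powRr1//; apply: le_trans; exact: ler_norm.
Unshelve. all: by end_near. Qed.

Section FixedParameters.
Variables (p beta : R) (lam : R -> R).
Hypotheses (p1 : 1 < p) (p2 : p < 2) (beta0 : 0 <= beta).
Hypothesis hlam : forall s, rate p s (lam s).

Let val s := lam (Num.sqrt beta * s) - s ^+ 2 / 2.
Let E := sup (range val).

Let val_le s : val s <= beta / 2 + lmgf p 0.
Proof.
have := rate_le p1 (hlam (Num.sqrt beta * s)).
rewrite normrM (ger0_norm (sqrtr_ge0 _)) /val.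
have hb : beta = Num.sqrt beta ^+ 2 by rewrite sqr_sqrtr.
have hs : s ^+ 2 = `|s| ^+ 2 by rewrite real_normK// num_real.
have := sqr_ge0 (Num.sqrt beta - `|s|); rewrite [in beta / 2]hb hs; nra.
Qed.

Let val_has_sup : has_sup (range val).
Proof.
split; first by exists (val 0), 0.
by exists (beta / 2 + lmgf p 0) => _ [s _ <-].
Qed.

Let val_le_E s : val s <= E.
Proof. by apply: (sup_upper_bound val_has_sup); exists s. Qed.

Let Zpart_near_ge e : 0 < e ->
  \forall n \near \oo, expR (n%:R * (E - e)) <= Zpart n p beta.
Proof.
move=> e0; have p0 : 0 < p := lt_trans ltr01 p1.
have e4 : 0 < e / 4 by lra.
have [_ [s _ <-] hs] := sup_adherent e4 val_has_sup.
rewrite -/E in hs.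
have H := hlam (Num.sqrt beta * s) e4.
(* The diagonal correction is [n] times [beta n^(-g) / 2], with [g > 0] since [p > 1]. *)
pose g := 2 - 2 / p.
have g0 : 0 < g.
  rewrite /g subr_gt0 ltr_pdivrMr//; have := p1; lra.
near=> n.
have n0 : 0 < n%:R :> R by near: n; exact: nbhs_infty_gtr.
have /andP[h1 _] : expR (n%:R * (lam (Num.sqrt beta * s) - e / 4)) <=
    c_p p ^+ n * sphmgf p n (Num.sqrt beta * s) <=
    expR (n%:R * (lam (Num.sqrt beta * s) + e / 4)) by near: n; exact: H.
have h2 : 2 * beta / e <= n%:R `^ g by near: n; exact: near_powR_ge.
apply: le_trans (Zpart_ge n s p1 p2 beta0).
apply: le_trans (ler_wpM2l (expR_ge0 _) h1).
rewrite -expRD ler_expR.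
have ng0 : 0 < n%:R `^ g by rewrite powR_gt0.
have nE : n%:R `^ (2 / p) = n%:R ^+ 2 / n%:R `^ g.
  rewrite -powR_mulrn ?(ltW n0)// -powRN -powRD ?(gt_eqF n0) ?implybT//.
  by congr (_ `^ _); rewrite /g; ring.
have h3 : beta * (n%:R `^ (2 / p) / (2 * n%:R)) <= n%:R * (e / 4).
  have -> : beta * (n%:R `^ (2 / p) / (2 * n%:R)) = n%:R * (beta / n%:R `^ g / 2).
    by rewrite nE; field; rewrite !gt_eqF.
  rewrite ler_pM2l//.
  have : beta / n%:R `^ g <= e / 2.
    by rewrite ler_pdivrMr//; move: h2; rewrite ler_pdivrMr//; lra.
  lra.
have h4 : n%:R * (E - e / 4) <= n%:R * val s by rewrite ler_pM2l// ltW.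
have h5 : 0 < n%:R * e by rewrite mulr_gt0.
rewrite /val in h4; lra.
Unshelve. all: by end_near. Qed.

Let Zpart_near_le e : 0 < e ->
  \forall n \near \oo, Zpart n p beta <= expR (n%:R * (E + e)).
Proof.
move=> e0; have e4 : 0 < e / 4 by lra.
(* Since [d <= 1], [d^2 <= d <= e / 4]; the number of grid points does not depend on [n] and is
   absorbed by [exp (n e / 2)]. *)
pose d := Num.min 1 (e / 4).
have d0 : 0 < d by rewrite lt_min ltr01.
have [G hG] := ex_grid (Num.sqrt beta) d0.
have hG' v : `|v| <= Num.sqrt beta ->
    exists2 s, s \in G & (v - s) ^+ 2 <= 2 * (e / 4).
  move=> /hG[s sG hs]; exists s => //; rewrite -[leLHS]real_normK ?num_real//.
  have d1 : d <= 1 by rewrite ge_min lexx.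
  have de : d <= e / 4 by rewrite ge_min lexx orbT.
  have := normr_ge0 (v - s); nra.
have H := near_all_seq G (fun s => hlam (Num.sqrt beta * s) e4).
have e2 : 0 < e / 2 by lra.
near=> n.
have hn : forall s, s \in G -> expR (n%:R * (lam (Num.sqrt beta * s) - e / 4)) <=
    c_p p ^+ n * sphmgf p n (Num.sqrt beta * s) <=
    expR (n%:R * (lam (Num.sqrt beta * s) + e / 4)) by near: n; exact: H.
have hsz : (size G)%:R <= expR (n%:R * (e / 2)) by near: n; exact: near_expRM_ge.
apply: (le_trans (Zpart_le n p1 p2 beta0 hG')).
apply: (@le_trans _ _ (\sum_(s <- G) expR (n%:R * (E + e / 2)))).
  rewrite big_seq [leRHS]big_seq; apply: ler_sum => s sG.
  have /andP[_ h2] := hn s sG.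
  apply: (le_trans (ler_wpM2l (expR_ge0 _) h2)).
  rewrite -expRD ler_expR -mulrDr ler_wpM2l//.
  by have := val_le_E s; rewrite /val; lra.
rewrite big_const_seq count_predT iter_addr_0 -[leLHS]mulr_natl.
rewrite (_ : E + e = e / 2 + (E + e / 2)); last by field.
by rewrite [in leRHS]mulrDr [leRHS]expRD ler_wpM2r ?expR_ge0.
Unshelve. all: by end_near. Qed.

(** Establishes that the limit exists, so [Ep] is a genuine limit and not a default value of
    [lim]. *)
Let cvg_Zpart : n%:R^-1 * ln (Zpart n p beta) @[n --> \oo] --> E.
Proof.
apply/cvgrPdist_le => e e0; near=> n.
have n0 : 0 < n%:R :> R by near: n; exact: nbhs_infty_gtr.
have h1 : expR (n%:R * (E - e)) <= Zpart n p beta by near: n; exact: Zpart_near_ge.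
have h2 : Zpart n p beta <= expR (n%:R * (E + e)) by near: n; exact: Zpart_near_le.
have Z0 : 0 < Zpart n p beta by apply: lt_le_trans h1; exact: expR_gt0.
rewrite -[Zpart n p beta]lnK ?posrE// ler_expR in h1.
rewrite -[Zpart n p beta]lnK ?posrE// ler_expR in h2.
rewrite distrC ler_distl; apply/andP; split.
  by rewrite mulrC ler_pdivlMr// mulrC.
by rewrite mulrC ler_pdivrMr// mulrC.
Unshelve. all: by end_near. Qed.

Let EpE : Ep p beta = E.
Proof. exact: cvg_lim cvg_Zpart. Qed.

Lemma Ep_ge s : lam (Num.sqrt beta * s) - s ^+ 2 / 2 <= Ep p beta.
Proof. by rewrite EpE; exact: val_le_E. Qed.

Lemma Ep_le (M : R) : (forall s, lam (Num.sqrt beta * s) - s ^+ 2 / 2 <= M) -> Ep p beta <= M.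
Proof.
move=> H; rewrite EpE; apply: ge_sup; first by exists (val 0), 0.
by move=> _ [s _ <-]; exact: H.
Qed.

End FixedParameters.

End Limits.

(** * Young duality between the two suprema *)

Section Duality.
Set Implicit Arguments. Unset Strict Implicit.
Context {R : realType}.
Implicit Types p s r x y z : R.

Definition radial p z : R := (1 + z `^ p) `^ p^-1.

Lemma radial_gt0 p z : 0 < radial p z.
Proof. by rewrite powR_gt0// ltr_pwDl ?powR_ge0. Qed.

Lemma radialK p z : p != 0 -> radial p z `^ p = 1 + z `^ p.
Proof.
by move=> pn0; rewrite /radial -powRrM mulVf// powRr1// addr_ge0 ?powR_ge0.
Qed.

(** Young's inequality for the exponents [2 / p] and [2 / (2 - p)], applied to [|s|^p] and
    [x^(p/2)]. *)
Lemma young_sqrt p x s : 1 < p -> p < 2 -> 0 <= x ->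
  (Num.sqrt x * `|s|) `^ p / p <=
  s ^+ 2 / 2 + (2 - p) / (2 * p) * x `^ (p / (2 - p)).
Proof.
move=> p1 p2 x0; have p0 : 0 < p by lra.
have q0 : 0 < 2 - p by lra.
have P0 : 0 < 2 / p by rewrite divr_gt0.
have Q0 : 0 < 2 / (2 - p) by rewrite divr_gt0.
have PQ : (2 / p)^-1 + (2 / (2 - p))^-1 = 1.
  by rewrite !invf_div; field.
have := conjugate_powR (powR_ge0 `|s| p) (powR_ge0 (Num.sqrt x) p) P0 Q0 PQ.
rewrite powRM ?sqrtr_ge0// -!powRrM.
have -> : p * (2 / p) = 2 by field; rewrite gt_eqF.
rewrite powR_mulrn// real_normK ?num_real// -powR12_sqrt// -!powRrM.
have -> : 2^-1 * (p * (2 / (2 - p))) = p / (2 - p) by field; rewrite gt_eqF.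
move=> /(ler_wpM2r (_ : 0 <= p^-1)); rewrite invr_ge0 => /(_ (ltW p0)).
rewrite [X in X / p <= _ -> _]mulrC => /le_trans; apply.
rewrite le_eqVlt; apply/orP; left; apply/eqP; field.
by rewrite !gt_eqF.
Qed.

(** For each [s] take [z = sqrt x |s|] and [r = radial p z] in [Lam <= Phi], so that
    [(r^p - 1) / p = z^p / p] is absorbed by [young_sqrt]. Negative [s] is covered by the evenness
    of [lmgf]. *)
Lemma Ep_sub_le p x y (M : R) : 1 < p -> p < 2 -> 0 <= x -> 0 <= y ->
  (forall z, 0 <= z ->
     lmgf p (Num.sqrt y * z / radial p z) - p^-1 * ln (1 + z `^ p) <= M) ->
  Ep p (x * y) - (2 - p) / (2 * p) * x `^ (p / (2 - p)) <= M.
Proof.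
move=> p1 p2 x0 y0 H; have p0 : 0 < p by lra.
have pn0 : p != 0 by rewrite gt_eqF.
have [lam hlam] := choice (fun s => ex_rate s p1).
rewrite lerBlDr; apply: (Ep_le p1 p2 (mulr_ge0 x0 y0) hlam) => s.
pose z := Num.sqrt x * `|s|.
have z0 : 0 <= z by rewrite mulr_ge0 ?sqrtr_ge0.
have r0 := radial_gt0 p z.
have h1 := rate_le_Phi p1 (hlam (Num.sqrt (x * y) * s)) r0.
have h2 := H z z0.
have h3 := young_sqrt s p1 p2 x0; rewrite -/z in h3.
have lr : ln (radial p z) = p^-1 * ln (1 + z `^ p) by rewrite /radial ln_powR.
have hl : lmgf p (Num.sqrt (x * y) * s / radial p z) = lmgf p (Num.sqrt y * z / radial p z).
  rewrite sqrtrM// /z; have [s0|s0] := leP 0 s.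
    by rewrite (ger0_norm s0); congr (lmgf _ (_ / _)); ring.
  by rewrite (ltr0_norm s0) -lmgfN//; congr (lmgf _ _); ring.
rewrite /Phi hl lr radialK// (_ : 1 + z `^ p - 1 = z `^ p) in h1; last by ring.
lra.
Qed.

(** The tilt [t] is read off from [z], and [r] is tilted for it. With [u = z r / radial p z], the
    choices [x = u^(2-p)] and [s = u^(p/2)] give [sqrt (x y) s = t r] and equality in Young's
    inequality. *)
Lemma term_le_Ep p y z : 1 < p -> p < 2 -> 0 <= y -> 0 <= z ->
  exists2 x, 0 <= x &
  lmgf p (Num.sqrt y * z / radial p z) - p^-1 * ln (1 + z `^ p) <=
  Ep p (x * y) - (2 - p) / (2 * p) * x `^ (p / (2 - p)).
Proof.
move=> p1 p2 y0 z0; have p0 : 0 < p by lra.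
have pn0 : p != 0 by rewrite gt_eqF.
have q0 : 0 < 2 - p by lra.
have [lam hlam] := choice (fun s => ex_rate s p1).
set rz := radial p z; have rz0 : 0 < rz by exact: radial_gt0.
set t := Num.sqrt y * z / rz.
have [r rt] := ex_tilted t p1; have r0 := rt.1.
pose u := z / rz * r.
have u0 : 0 <= u by rewrite mulr_ge0 ?divr_ge0 ?(ltW rz0) ?(ltW r0).
exists (u `^ (2 - p)); first exact: powR_ge0.
have x0 := powR_ge0 u (2 - p).
have := Ep_ge p1 p2 (mulr_ge0 x0 y0) hlam (u `^ (p / 2)).
have -> : Num.sqrt (u `^ (2 - p) * y) * u `^ (p / 2) = t * r.
  rewrite sqrtrM// -powR12_sqrt// -powRrM mulrAC -powRD; last first.
    by rewrite (_ : _ + _ = 1) ?oner_eq0//; field.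
  have -> : (2 - p) / 2 + p / 2 = 1 by field.
  by rewrite powRr1// /u /t; ring.
have h1 : Phi p (t * r) r <= lam (t * r).
  by apply: rate_ge_Phi => //; rewrite mulfK ?gt_eqF.
have -> : (u `^ (p / 2)) ^+ 2 = u `^ p.
  by rewrite -powR_mulrn ?powR_ge0// -powRrM; congr (_ `^ _); field.
have -> : u `^ (2 - p) `^ (p / (2 - p)) = u `^ p.
  by rewrite -powRrM; congr (_ `^ _); field; rewrite gt_eqF.
rewrite /Phi mulfK ?gt_eqF// in h1.
(* As [u^p = r^p - v] and [ln v = p ln r - ln (1 + z^p)], what remains to prove is
   [ln v <= v - 1]. *)
pose v := r `^ p / rz `^ p.
have v0 : 0 < v by rewrite /v; apply: divr_gt0; exact: powR_gt0.
have uE : u `^ p = r `^ p - v.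
  have -> : u `^ p = z `^ p * v.
    rewrite /u powRM ?divr_ge0 ?(ltW rz0) ?(ltW r0)// powRM ?invr_ge0 ?(ltW rz0)//.
    rewrite /v -(powR_inv1 (ltW rz0)) -powRrM mulN1r powRN.
    by rewrite mulrAC mulrA.
  have zE : z `^ p = rz `^ p - 1 by rewrite /rz radialK// addrC addKr.
  rewrite zE /v; field.
  by rewrite gt_eqF// powR_gt0.
have lnv : ln v = p * ln r - ln (1 + z `^ p).
  have -> : ln v = ln (r `^ p) - ln (rz `^ p) by rewrite /v; apply: ln_div; rewrite posrE; exact: powR_gt0.
  by rewrite /rz radialK// ln_powR.
have hv : ln v <= v - 1.
  have := @le_ln1Dx R (v - 1); rewrite (_ : 1 + (v - 1) = v); last by ring.
  by apply; lra.
have hv' : ln r - p^-1 * ln (1 + z `^ p) <= (v - 1) / p.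
  rewrite ler_pdivlMr//.
  have -> : (ln r - p^-1 * ln (1 + z `^ p)) * p = ln v by rewrite lnv; field.
  exact: hv.
have hs : u `^ p / 2 + (2 - p) / (2 * p) * u `^ p = u `^ p / p by field.
rewrite uE in hs *.
have : (r `^ p - 1) / p = (r `^ p - v) / p + (v - 1) / p by field.
lra.
Qed.

End Duality.

(** * The identity and the bound as extended real suprema and infima *)

Theorem theorem1p3 (R : realType) (p : R) (hp1 : 1 < p) (hp2 : p < 2) :
  (forall y : R, 0 <= y ->
     ereal_sup [set (psi p (Num.sqrt y * z / (1 + `|z| `^ p) `^ p^-1)
                     - p^-1 * ln (1 + `|z| `^ p))%:E | z in [set z : R | 0 <= z]]
     = ereal_sup [set (Ep p (x * y)
                     - (2 - p) / (2 * p) * x `^ (p / (2 - p)))%:E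
                  | x in [set x : R | 0 <= x]])
  /\
  (forall beta : R, 0 <= beta ->
     ((Ep p beta)%:E <=
      ereal_inf [set ereal_sup
                   [set (psi p (Num.sqrt beta * z * w / (1 + z `^ p) `^ p^-1)
                         - p^-1 * ln (1 + `|z| `^ p)
                         + (2 - p) / (2 * p) * w `^ (2 * p / (p - 2)))%R%:E
                   | z in [set z : R | (0 <= z)%R]]
                 | w in [set w : R | (0 < w)%R]])%E).
Proof.
split=> [y y0|beta beta0].
  apply/eqP; rewrite eq_le; apply/andP; split.
    apply: ge_ereal_sup => _ [z z0 <-]; rewrite /= in z0.
    have [x x0 hx] := term_le_Ep hp1 hp2 y0 z0.
    apply: (@le_trans _ _ (Ep p (x * y) - (2 - p) / (2 * p) * x `^ (p / (2 - p)))%:E).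
      by rewrite lmgf.unlock in hx; rewrite lee_fin (ger0_norm z0).
    by apply: ereal_sup_ubound; exists x.
  apply: ge_ereal_sup => _ [x x0 <-]; rewrite /= in x0.
  set T := ereal_sup _.
  have hT z : 0 <= z -> ((lmgf p (Num.sqrt y * z / radial p z) -
      p^-1 * ln (1 + z `^ p))%R%:E <= T)%E.
    move=> z0; apply: ereal_sup_ubound; exists z; first exact: z0.
    by rewrite (ger0_norm z0) lmgf.unlock.
  (* The value [z = 0] excludes [-oo], and [+oo] bounds everything. *)
  case: T hT => [M| |] hT; last by have := hT 0 (lexx 0).
    by rewrite lee_fin; apply: Ep_sub_le => // z z0; rewrite -lee_fin; exact: hT.
  by rewrite leey.
apply: le_ereal_inf_tmp => _ [w w0 <-]; rewrite /= in w0.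
set T := ereal_sup _.
(* Chosen so that [x y = beta] and [x^(p/(2-p)) = w^(2p/(p-2))]; the bound is then one half of the
   duality at this [x]. *)
pose y := beta * w ^+ 2; pose x := w `^ (-2).
have y0 : 0 <= y by rewrite mulr_ge0 ?sqr_ge0.
have x0 : 0 <= x by exact: powR_ge0.
have xy : x * y = beta.
  rewrite /x /y powRN powR_mulrn ?(ltW w0)// mulrCA mulVf ?mulr1//.
  by rewrite expf_neq0// gt_eqF.
have xp : x `^ (p / (2 - p)) = w `^ (2 * p / (p - 2)).
  rewrite /x -powRrM; congr (_ `^ _); field.
  by apply/andP; split; [rewrite lt_eqF// subr_lt0|rewrite gt_eqF// subr_gt0].
have hT z : 0 <= z -> ((lmgf p (Num.sqrt y * z / radial p z) -
    p^-1 * ln (1 + z `^ p) + (2 - p) / (2 * p) * x `^ (p / (2 - p)))%R%:E <= T)%E.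
  move=> z0; apply: ereal_sup_ubound; exists z; first exact: z0.
  have e : Num.sqrt y * z / radial p z = Num.sqrt beta * z * w / (1 + z `^ p) `^ p^-1.
    by rewrite /y sqrtrM// sqrtr_sqr (gtr0_norm w0) /radial; congr (_ / _); ring.
  by rewrite (ger0_norm z0) e xp lmgf.unlock.
case: T hT => [M| |] hT; last by have := hT 0 (lexx 0).
  have := @Ep_sub_le R p x y (M - (2 - p) / (2 * p) * x `^ (p / (2 - p))) hp1 hp2 x0 y0.
  rewrite xy lerD2r lee_fin; apply => z z0.
  by rewrite lerBrDr -lee_fin; exact: hT.
by rewrite leey.
Qed.
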